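(* Let $\Pi,\Pi_1,\Pi_2,\Pi_{12}$ be (not necessarily commutative) Banach algebras fitting into a commutative square of bounded homomorphisms $\Pi\to\Pi_1$, $\Pi\to\Pi_2$, $\Pi_1\to\Pi_{12}$, $\Pi_2\to\Pi_{12}$ such that (a) the sequence $0\to\Pi\to\Pi_1\oplus\Pi_2\to\Pi_{12}\to0$, whose last nontrivial map is the difference of the two given maps, is strict exact; (b) the map $\Pi_2\to\Pi_{12}$ has dense image. Let $(M_1,M_2,M_{12})$ be a finite projective glueing datum of bimodules over this square. Then the kernel $M$ of the difference map $M_1\oplus M_2\to M_{12}$ is a finite projective bimodule over $\Pi$, and the natural maps are isomorphisms $$M\otimes_{\Pi}\Pi_1\xrightarrow{\sim}M_1,\qquad M\otimes_{\Pi}\Pi_2\xrightarrow{\sim}M_2$$ (base change being understood on the right for the right module structures, and on the left, $\Pi_i\otimes_\Pi M\xrightarrow{\sim}M_i$, for the left module structures).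
   Context: A bimodule over a ring is called finite projective if it is finite projective both as a left module and as a right module. A finite projective glueing datum of bimodules consists of finite projective bimodules $M_1,M_2,M_{12}$ over $\Pi_1,\Pi_2,\Pi_{12}$ respectively, with bimodule maps $M_i\to M_{12}$ (over $\Pi_i\to\Pi_{12}$), $i=1,2$, inducing isomorphisms $M_i\otimes_{\Pi_i}\Pi_{12}\cong M_{12}$ of right modules and $\Pi_{12}\otimes_{\Pi_i}M_i\cong M_{12}$ of left modules. A bounded homomorphism is strict if the quotient norm on its image is equivalent to the subspace norm; a sequence is strict exact if it is exact with strict maps. *)

(* Defs.v *)
From HB Require Import structures.
From mathcomp Require Import all_boot all_order all_algebra.
From mathcomp Require Import boolp classical_sets reals.
From mathcomp Require Import freeg.

Set Implicit Arguments.
Unset Strict Implicit.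
Unset Printing Implicit Defensive.
Import Order.TTheory GRing.Theory Num.Theory.
Local Open Scope ring_scope.
Local Open Scope quotient_scope.

(* MathComp's normedZmodType requires `|x *+ n| = `|x| *+ n, which excludes
   nonarchimedean norms, and its algType excludes the zero ring.  The classes
   below impose neither condition. *)

HB.mixin Record isNormedGroup (R : realType) V of GRing.Zmodule V := {
  bnorm : V -> R;
  bnorm_eq0 : forall x, bnorm x = 0 <-> x = 0;
  bnormN : forall x, bnorm (- x) = bnorm x;
  bnormD : forall x y, bnorm (x + y) <= bnorm x + bnorm y
}.
#[short(type="normedGroupType")]
HB.structure Definition NormedGroup (R : realType) :=
  {V of GRing.Zmodule V & isNormedGroup R V}.

Section NormedGroup.
Variables (R : realType) (V W : normedGroupType R).

Definition cauchy_seq (u : nat -> V) : Prop :=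
  forall e : R, 0 < e ->
    exists N, forall m n, (N <= m)%N -> (N <= n)%N -> bnorm (u m - u n) < e.

Definition converges_to (u : nat -> V) (l : V) : Prop :=
  forall e : R, 0 < e -> exists N, forall n, (N <= n)%N -> bnorm (u n - l) < e.

Definition norm_complete : Prop :=
  forall u : nat -> V, cauchy_seq u -> exists l, converges_to u l.

Definition norm_bounded (f : V -> W) : Prop :=
  exists C : R, forall x, bnorm (f x) <= C * bnorm x.

Definition dense_image (f : V -> W) : Prop :=
  forall (y : W) (e : R), 0 < e -> exists x, bnorm (y - f x) < e.

Definition quotient_norm (f : V -> W) (y : W) : R :=
  inf [set bnorm x | x in [set x | f x = y]]%classic.

Definition strict (f : V -> W) : Prop :=
  norm_bounded f /\
  exists c C : R, [/\ 0 < c, 0 < C &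
    forall y, (exists x, f x = y) ->
      c * bnorm y <= quotient_norm f y <= C * bnorm y].

End NormedGroup.

Arguments norm_complete {R} V.

(* The direct sum carries the max norm. *)
Section ProductNorm.
Variables (R : realType) (V W : normedGroupType R).

Definition prod_norm (p : V * W) : R := Num.max (bnorm p.1) (bnorm p.2).

Lemma bnorm_ge0 (U : normedGroupType R) (x : U) : 0 <= bnorm x.
Proof.
have : bnorm (x - x) <= bnorm x + bnorm (- x) by exact: bnormD.
rewrite subrr bnormN (_ : bnorm 0 = 0); last by apply/bnorm_eq0.
by rewrite -mulr2n pmulrn_lge0.
Qed.

Lemma prod_norm_eq0 p : prod_norm p = 0 <-> p = 0.
Proof.
split=> [p0 | ->]; last first.
  have n0 (U : normedGroupType R) : bnorm (0 : U) = 0 by apply/bnorm_eq0.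
  by rewrite /prod_norm !n0 maxxx.
have /andP[l1 l2] : (bnorm p.1 <= 0) && (bnorm p.2 <= 0).
  by rewrite -ge_max -/(prod_norm p) p0.
case: p {p0} l1 l2 => x y /= l1 l2.
have /bnorm_eq0-> : bnorm x = 0 by apply/eqP; rewrite eq_le l1 bnorm_ge0.
by have /bnorm_eq0-> : bnorm y = 0 by apply/eqP; rewrite eq_le l2 bnorm_ge0.
Qed.

Lemma prod_normN p : prod_norm (- p) = prod_norm p.
Proof. by rewrite /prod_norm !bnormN. Qed.

Lemma prod_normD p q : prod_norm (p + q) <= prod_norm p + prod_norm q.
Proof.
rewrite /prod_norm ge_max; apply/andP; split; apply: le_trans (bnormD _ _) _;
  by apply: lerD; rewrite le_max lexx ?orbT.
Qed.

HB.instance Definition _ := isNormedGroup.Build R (V * W)%type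
  prod_norm_eq0 prod_normN prod_normD.

End ProductNorm.

Definition short_strict_exact (R : realType) (U V W : normedGroupType R)
    (f : U -> V) (g : V -> W) : Prop :=
  [/\ strict f, strict g, injective f,
      (forall v, g v = 0 <-> exists u, f u = v) &
      (forall w, exists v, g v = w)].

HB.mixin Record NormedGroup_isBanachRing (R : realType) A
    of GRing.PzRing A & NormedGroup R A := {
  bnormM : forall x y : A, bnorm (x * y) <= bnorm x * bnorm y;
  bnorm_complete : norm_complete A
}.
#[short(type="banachRingType")]
HB.structure Definition BanachRing (R : realType) :=
  {A of GRing.PzRing A & NormedGroup R A & NormedGroup_isBanachRing R A}.

#[short(type="comBanachRingType")]
HB.structure Definition ComBanachRing (R : realType) :=
  {A of GRing.ComPzRing A & BanachRing R A}.

(* A k-algebra is a ring A with a ring homomorphism from k to its centre. *)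
HB.mixin Record BanachRing_isBanachAlg (R : realType) (k : comBanachRingType R) A
    of BanachRing R A := {
  balg : {rmorphism k -> A};
  balgC : forall (c : k) (x : A), balg c * x = x * balg c;
  balg_bounded : norm_bounded balg
}.
#[short(type="banachAlgType")]
HB.structure Definition BanachAlg (R : realType) (k : comBanachRingType R) :=
  {A of BanachRing R A & BanachRing_isBanachAlg R k A}.

Record boundedHom (R : realType) (k : comBanachRingType R)
    (A B : banachAlgType k) := BoundedHom {
  bhom_fun :> {rmorphism A -> B};
  bhom_alg : forall c : k, bhom_fun (balg c) = balg c;
  bhom_bounded : norm_bounded bhom_fun
}.

(* A right A-module is an lmodType over the converse ring A^c. *)

HB.mixin Record Lmodule_isBimodule (A : pzRingType) M of GRing.Lmodule A M := {
  rscale : M -> A -> M;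
  rscalerA : forall x a b, rscale (rscale x a) b = rscale x (a * b);
  rscaler1 : forall x, rscale x 1 = x;
  rscalerDl : forall x y a, rscale (x + y) a = rscale x a + rscale y a;
  rscalerDr : forall x a b, rscale x (a + b) = rscale x a + rscale x b;
  lrscalerA : forall (a : A) x b, rscale (a *: x) b = a *: rscale x b
}.
#[short(type="bimodType")]
HB.structure Definition Bimodule (A : pzRingType) :=
  {M of GRing.Lmodule A M & Lmodule_isBimodule A M}.

(* The underlying right module of a bimodule. *)
Definition rmod (A : pzRingType) (M : bimodType A) : Type := M.

Section RightModule.
Variables (A : pzRingType) (M : bimodType A).

HB.instance Definition _ := GRing.Zmodule.on (rmod M).

Definition rmod_scale (a : A^c) (x : rmod M) : rmod M := rscale (x : M) a.

Fact rmod_scalerA a b x :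
  rmod_scale a (rmod_scale b x) = rmod_scale (a * b) x.
Proof. exact: rscalerA. Qed.
Fact rmod_scale1r : left_id 1 rmod_scale.
Proof. by move=> x; apply: rscaler1. Qed.
Fact rmod_scalerDr : right_distributive rmod_scale +%R.
Proof. by move=> a x y; apply: rscalerDl. Qed.
Fact rmod_scalerDl x : {morph rmod_scale^~ x : a b / a + b}.
Proof. by move=> a b; apply: rscalerDr. Qed.

HB.instance Definition _ := GRing.Zmodule_isLmodule.Build A^c (rmod M)
  rmod_scalerA rmod_scale1r rmod_scalerDr rmod_scalerDl.

End RightModule.

Definition finitely_generated (A : pzRingType) (M : lmodType A) : Prop :=
  exists n (v : 'I_n -> M), forall x, exists c : 'I_n -> A,
    x = \sum_(i < n) c i *: v i.

Definition projective (A : pzRingType) (M : lmodType A) : Prop :=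
  forall (X Y : lmodType A) (g : {linear X -> Y}) (h : {linear M -> Y}),
    (forall y, exists x, g x = y) ->
    exists s : {linear M -> X}, forall m, g (s m) = h m.

Definition finite_projective (A : pzRingType) (M : lmodType A) : Prop :=
  finitely_generated M /\ projective M.

Definition finite_projective_bimod (A : pzRingType) (M : bimodType A) : Prop :=
  finite_projective M /\ finite_projective (rmod M).

(* Balanced biadditive maps; a *: m is m . a, since M is a right module. *)
Record balanced (A : pzRingType) (M : lmodType A^c) (N : lmodType A)
    (G : zmodType) := Balanced {
  balanced_fun :> M -> N -> G;
  balancedDl : forall m m' n,
    balanced_fun (m + m') n = balanced_fun m n + balanced_fun m' n;
  balancedDr : forall m n n',
    balanced_fun m (n + n') = balanced_fun m n + balanced_fun m n';
  balancedA : forall m (a : A) n,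
    balanced_fun ((a : A^c) *: m) n = balanced_fun m (a *: n)
}.

Section Tensor.
Variables (A : pzRingType) (M : lmodType A^c) (N : lmodType A).

Definition pure (m : M) (n : N) : {freeg (M * N)} := << (m, n) >>.

(* The subgroup of the free abelian group on M x N generated by the relations
   of M (x)_A N. *)
Inductive tensor_rel : {freeg (M * N)} -> Prop :=
| TensorRel0 : tensor_rel 0
| TensorRelB x y : tensor_rel x -> tensor_rel y -> tensor_rel (x - y)
| TensorRelDl m m' n :
    tensor_rel (pure (m + m') n - pure m n - pure m' n)
| TensorRelDr m n n' :
    tensor_rel (pure m (n + n') - pure m n - pure m n')
| TensorRelA m (a : A) n :
    tensor_rel (pure ((a : A^c) *: m) n - pure m (a *: n)).

Definition tensor_relb : {freeg (M * N)} -> bool := fun x => `[< tensor_rel x >].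

Fact tensor_rel_zmod_closed : zmod_closed tensor_relb.
Proof.
split; first exact/asboolP/TensorRel0.
by move=> x y /asboolP hx /asboolP hy; apply/asboolP/TensorRelB.
Qed.

HB.instance Definition _ :=
  GRing.isZmodClosed.Build {freeg (M * N)} tensor_relb tensor_rel_zmod_closed.

Definition tensor_rels : zmodClosed {freeg (M * N)} :=
  GRing.ZmodClosed.clone _ tensor_relb _.

Definition tensor : Type := {ideal_quot tensor_rels}.

HB.instance Definition _ := Quotient.on tensor.
HB.instance Definition _ := GRing.Zmodule.on tensor.

Definition tens (m : M) (n : N) : tensor := \pi_tensor (pure m n).

Lemma tensE_eq (x y : {freeg (M * N)}) : tensor_rel (x - y) ->
  \pi_tensor x = \pi_tensor y.
Proof.
by move=> h; apply/eqP; rewrite -(Quotient.idealrBE tensor_rels); apply/asboolP.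
Qed.

Lemma tensor_piB x y : \pi_tensor (x - y) = \pi_tensor x - \pi_tensor y.
Proof. exact: (raddfB (\pi_{ideal_quot tensor_rels})). Qed.

Lemma tensor_piD x y : \pi_tensor (x + y) = \pi_tensor x + \pi_tensor y.
Proof. exact: (raddfD (\pi_{ideal_quot tensor_rels})). Qed.


Lemma tensDl m m' n : tens (m + m') n = tens m n + tens m' n.
Proof.
rewrite /tens -tensor_piD; apply: tensE_eq; rewrite opprD addrA.
exact: TensorRelDl.
Qed.

Lemma tensDr m n n' : tens m (n + n') = tens m n + tens m n'.
Proof.
rewrite /tens -tensor_piD; apply: tensE_eq; rewrite opprD addrA.
exact: TensorRelDr.
Qed.

Lemma tensA m (a : A) n : tens ((a : A^c) *: m) n = tens m (a *: n).
Proof. by apply: tensE_eq; apply: TensorRelA. Qed.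

Lemma freeg_ind_pure (P : {freeg (M * N)} -> Prop) : P 0 ->
  (forall x y, P x -> P y -> P (x - y)) -> (forall m n, P (pure m n)) ->
  forall x, P x.
Proof.
move=> P0 PB Pp x.
have PN y : P y -> P (- y) by rewrite -sub0r; apply: PB.
have PD y z : P y -> P z -> P (y + z).
  by move=> Py Pz; rewrite -[z]opprK; apply: PB => //; apply: PN.
rewrite -(freeg_sumE x); elim/big_ind: _ => // -[m n] _.
have -> : << coeff (m, n) x *g (m, n) >> = pure m n *~ coeff (m, n) x.
  by rewrite /pure freegU_mulz intz.
have PM j : P (pure m n *+ j).
  by elim: j => [|j IH]; rewrite ?mulr0n // mulrS; apply: PD.
by case: (coeff _ _) => j; rewrite ?NegzE ?mulrNz -?pmulrn //; apply: PN.
Qed.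

Lemma tensor_ind (P : tensor -> Prop) : P 0 ->
  (forall x y, P x -> P y -> P (x - y)) -> (forall m n, P (tens m n)) ->
  forall x, P x.
Proof.
move=> P0 PB Pp x; rewrite -[x]reprK.
apply: (freeg_ind_pure (P := fun y => P (\pi_tensor y))).
- by rewrite -[X in \pi_tensor X](subrr 0) tensor_piB subrr.
- by move=> x1 x2 Px1 Px2; rewrite tensor_piB; apply: PB.
- exact: Pp.
Qed.

Section Lift.
Variables (G : zmodType) (g : balanced M N G).

Definition freeg_lift (x : {freeg (M * N)}) : G :=
  fglift (fun p : M * N => g p.1 p.2 : zmodule G) x.

Lemma freeg_liftB : {morph freeg_lift : x y / x - y}.
Proof.
exact: (lift_is_additive (fun p : M * N => g p.1 p.2 : zmodule G)).
Qed.

Lemma freeg_lift_pure m n : freeg_lift (pure m n) = g m n.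
Proof. by rewrite /freeg_lift liftU scale1r. Qed.

Lemma freeg_lift_rel x : tensor_rel x -> freeg_lift x = 0.
Proof.
elim=> {x} [|x y _ hx _ hy|m m' n|m n n'|m a n].
- by have := freeg_liftB 0 0; rewrite !subrr.
- by rewrite freeg_liftB hx hy subrr.
- by rewrite !freeg_liftB !freeg_lift_pure balancedDl -addrA -opprD subrr.
- by rewrite !freeg_liftB !freeg_lift_pure balancedDr -addrA -opprD subrr.
- by rewrite freeg_liftB !freeg_lift_pure balancedA subrr.
Qed.

Definition tensor_lift_def (t : tensor) : G := freeg_lift (repr t).

Lemma tensor_lift_pi x :
  tensor_lift_def (\pi_tensor x) = freeg_lift x.
Proof.
apply/eqP; rewrite -subr_eq0 -freeg_liftB; apply/eqP/freeg_lift_rel.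
apply/asboolP; rewrite -[`[< _ >]]/(_ \in tensor_rels).
rewrite (Quotient.idealrBE tensor_rels).
by rewrite reprK.
Qed.

Fact tensor_lift_zmod_morphism : zmod_morphism tensor_lift_def.
Proof.
move=> x y; rewrite -[x]reprK -[y]reprK -tensor_piB !tensor_lift_pi.
exact: freeg_liftB.
Qed.

HB.instance Definition _ :=
  GRing.isZmodMorphism.Build tensor G tensor_lift_def tensor_lift_zmod_morphism.

(* The additive map m (x) n |-> g m n. *)
Definition tensor_lift : {additive tensor -> G} := tensor_lift_def.

Lemma tensor_liftE m n : tensor_lift (tens m n) = g m n.
Proof. by rewrite /= tensor_lift_pi freeg_lift_pure. Qed.

End Lift.

Lemma eq_tensor_additive (G : zmodType) (f g : {additive tensor -> G}) :
  (forall m n, f (tens m n) = g (tens m n)) -> f =1 g.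
Proof.
move=> fg; apply: tensor_ind => [|x y hx hy|//]; first by rewrite !raddf0.
by rewrite !raddfB hx hy.
Qed.

End Tensor.

(* B as a left, resp. right, A-module through f : A -> B. *)
Definition lrestr (A B : pzRingType) (f : {rmorphism A -> B}) : Type := B.
Definition rrestr (A B : pzRingType) (f : {rmorphism A -> B}) : Type := B.

Section Restriction.
Variables (A B : pzRingType) (f : {rmorphism A -> B}).

HB.instance Definition _ := GRing.Zmodule.on (lrestr f).
HB.instance Definition _ := GRing.Zmodule.on (rrestr f).

Definition lrestr_scale (a : A) (b : lrestr f) : lrestr f := f a * (b : B).
Definition rrestr_scale (a : A^c) (b : rrestr f) : rrestr f := (b : B) * f a.

Fact lrestr_scalerA a b x :
  lrestr_scale a (lrestr_scale b x) = lrestr_scale (a * b) x.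
Proof. by rewrite /lrestr_scale rmorphM mulrA. Qed.
Fact lrestr_scale1r : left_id 1 lrestr_scale.
Proof. by move=> x; rewrite /lrestr_scale rmorph1 mul1r. Qed.
Fact lrestr_scalerDr : right_distributive lrestr_scale +%R.
Proof. by move=> a x y; rewrite /lrestr_scale mulrDr. Qed.
Fact lrestr_scalerDl x : {morph lrestr_scale^~ x : a b / a + b}.
Proof. by move=> a b; rewrite /lrestr_scale rmorphD mulrDl. Qed.
HB.instance Definition _ := GRing.Zmodule_isLmodule.Build A (lrestr f)
  lrestr_scalerA lrestr_scale1r lrestr_scalerDr lrestr_scalerDl.

Fact rrestr_scalerA a b x :
  rrestr_scale a (rrestr_scale b x) = rrestr_scale (a * b) x.
Proof. by rewrite /rrestr_scale (rmorphM f b a) mulrA. Qed.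
Fact rrestr_scale1r : left_id 1 rrestr_scale.
Proof. by move=> x; rewrite /rrestr_scale (rmorph1 f) mulr1. Qed.
Fact rrestr_scalerDr : right_distributive rrestr_scale +%R.
Proof. by move=> a x y; rewrite /rrestr_scale mulrDl. Qed.
Fact rrestr_scalerDl x : {morph rrestr_scale^~ x : a b / a + b}.
Proof. by move=> a b; rewrite /rrestr_scale (rmorphD f) mulrDr. Qed.
HB.instance Definition _ := GRing.Zmodule_isLmodule.Build A^c (rrestr f)
  rrestr_scalerA rrestr_scale1r rrestr_scalerDr rrestr_scalerDl.

End Restriction.

(* The right B-module M (x)_A B and the left B-module B (x)_A M. *)
Definition rbase_change (A B : pzRingType) (f : {rmorphism A -> B})
  (M : bimodType A) : Type := tensor (rmod M) (lrestr f).
Definition lbase_change (A B : pzRingType) (f : {rmorphism A -> B})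
  (M : bimodType A) : Type := tensor (rrestr f) M.

Section BaseChange.
Variables (A B : pzRingType) (f : {rmorphism A -> B}) (M : bimodType A).

HB.instance Definition _ := GRing.Zmodule.on (rbase_change f M).
HB.instance Definition _ := GRing.Zmodule.on (lbase_change f M).

Definition rbc_mul_fun (c : B^c) (m : rmod M) (b : lrestr f) :
  rbase_change f M := tens m ((b : B) * (c : B) : lrestr f).
Fact rbc_mulDl c m m' b :
  rbc_mul_fun c (m + m') b = rbc_mul_fun c m b + rbc_mul_fun c m' b.
Proof. exact: tensDl. Qed.
Fact rbc_mulDr c m b b' :
  rbc_mul_fun c m (b + b') = rbc_mul_fun c m b + rbc_mul_fun c m b'.
Proof. by rewrite /rbc_mul_fun mulrDl; apply: tensDr. Qed.
Fact rbc_mulA c m (a : A) b :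
  rbc_mul_fun c ((a : A^c) *: m) b = rbc_mul_fun c m (a *: b).
Proof. by rewrite /rbc_mul_fun tensA; congr tens; rewrite -mulrA. Qed.

(* (m (x) b) . c = m (x) b c *)
Definition rbc_scale (c : B^c) : rbase_change f M -> rbase_change f M :=
  tensor_lift (Balanced (rbc_mulDl c) (rbc_mulDr c) (rbc_mulA c)).

Lemma rbc_scaleE c (m : rmod M) (b : lrestr f) :
  rbc_scale c (tens m b) = tens m ((b : B) * (c : B) : lrestr f).
Proof. exact: tensor_liftE. Qed.

Fact rbc_scalerDr : right_distributive rbc_scale +%R.
Proof. by move=> c x y; apply: raddfD. Qed.
Fact rbc_scalerA c d x : rbc_scale c (rbc_scale d x) = rbc_scale (c * d) x.
Proof.
move: x; apply: tensor_ind => [|x y hx hy|m b].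
- by rewrite /rbc_scale !raddf0.
- by rewrite {}/rbc_scale !raddfB in hx hy *; rewrite hx hy.
- by rewrite !rbc_scaleE -mulrA.
Qed.
Fact rbc_scale1r : left_id 1 rbc_scale.
Proof.
apply: tensor_ind => [|x y hx hy|m b]; first by rewrite /rbc_scale raddf0.
- by rewrite {}/rbc_scale raddfB in hx hy *; rewrite hx hy.
- by rewrite rbc_scaleE (mulr1 (b : B)).
Qed.
Fact rbc_scalerDl x : {morph rbc_scale^~ x : c d / c + d}.
Proof.
move=> c d; move: x; apply: tensor_ind => [|x y hx hy|m b].
- by rewrite /rbc_scale !raddf0 addr0.
- by rewrite {}/rbc_scale !raddfB in hx hy *; rewrite hx hy opprD addrACA.
- by rewrite !rbc_scaleE (mulrDr (b : B)); apply: tensDr.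
Qed.
HB.instance Definition _ := GRing.Zmodule_isLmodule.Build B^c
  (rbase_change f M) rbc_scalerA rbc_scale1r rbc_scalerDr rbc_scalerDl.

Definition lbc_mul_fun (c : B) (b : rrestr f) (m : M) :
  lbase_change f M := tens (c * (b : B) : rrestr f) m.
Fact lbc_mulDl c b b' m :
  lbc_mul_fun c (b + b') m = lbc_mul_fun c b m + lbc_mul_fun c b' m.
Proof. by rewrite /lbc_mul_fun mulrDr; apply: tensDl. Qed.
Fact lbc_mulDr c b m m' :
  lbc_mul_fun c b (m + m') = lbc_mul_fun c b m + lbc_mul_fun c b m'.
Proof. exact: tensDr. Qed.
Fact lbc_mulA c b (a : A) m :
  lbc_mul_fun c ((a : A^c) *: b) m = lbc_mul_fun c b (a *: m).
Proof. by rewrite /lbc_mul_fun -tensA; congr tens; rewrite [LHS]mulrA. Qed.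

(* c . (b (x) m) = c b (x) m *)
Definition lbc_scale (c : B) : lbase_change f M -> lbase_change f M :=
  tensor_lift (Balanced (lbc_mulDl c) (lbc_mulDr c) (lbc_mulA c)).

Lemma lbc_scaleE c (b : rrestr f) (m : M) :
  lbc_scale c (tens b m) = tens (c * (b : B) : rrestr f) m.
Proof. exact: tensor_liftE. Qed.

Fact lbc_scalerDr : right_distributive lbc_scale +%R.
Proof. by move=> c x y; apply: raddfD. Qed.
Fact lbc_scalerA c d x : lbc_scale c (lbc_scale d x) = lbc_scale (c * d) x.
Proof.
move: x; apply: tensor_ind => [|x y hx hy|b m].
- by rewrite /lbc_scale !raddf0.
- by rewrite {}/lbc_scale !raddfB in hx hy *; rewrite hx hy.
- by rewrite !lbc_scaleE mulrA.
Qed.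
Fact lbc_scale1r : left_id 1 lbc_scale.
Proof.
apply: tensor_ind => [|x y hx hy|b m]; first by rewrite /lbc_scale raddf0.
- by rewrite {}/lbc_scale raddfB in hx hy *; rewrite hx hy.
- by rewrite lbc_scaleE (mul1r (b : B)).
Qed.
Fact lbc_scalerDl x : {morph lbc_scale^~ x : c d / c + d}.
Proof.
move=> c d; move: x; apply: tensor_ind => [|x y hx hy|b m].
- by rewrite /lbc_scale !raddf0 addr0.
- by rewrite {}/lbc_scale !raddfB in hx hy *; rewrite hx hy opprD addrACA.
- by rewrite !lbc_scaleE (mulrDl c d (b : B)); apply: tensDl.
Qed.
HB.instance Definition _ := GRing.Zmodule_isLmodule.Build B
  (lbase_change f M) lbc_scalerA lbc_scale1r lbc_scalerDr lbc_scalerDl.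

Lemma rbc_ind (P : rbase_change f M -> Prop) : P 0 ->
  (forall x y, P x -> P y -> P (x - y)) ->
  (forall (m : rmod M) (b : lrestr f), P (tens m b)) -> forall x, P x.
Proof. exact: tensor_ind. Qed.

Lemma lbc_ind (P : lbase_change f M -> Prop) : P 0 ->
  (forall x y, P x -> P y -> P (x - y)) ->
  (forall (b : rrestr f) (m : M), P (tens b m)) -> forall x, P x.
Proof. exact: tensor_ind. Qed.

End BaseChange.

(* Bimodule maps M -> N over f : A -> B. *)
Record bimodHom (A B : pzRingType) (f : {rmorphism A -> B})
    (M : bimodType A) (N : bimodType B) := BimodHom {
  bimod_fun :> {additive M -> N};
  bimod_funZl : forall (a : A) x, bimod_fun (a *: x) = f a *: bimod_fun x;
  bimod_funZr : forall x (a : A),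
    bimod_fun (rscale x a) = rscale (bimod_fun x) (f a)
}.

Section NaturalMaps.
Variables (A B : pzRingType) (f : {rmorphism A -> B}).
Variables (M : bimodType A) (N : bimodType B) (phi : bimodHom f M N).

Definition rbc_map_fun (m : rmod M) (b : lrestr f) : rmod N :=
  rscale (phi (m : M)) (b : B).
Fact rbc_map_funDl m m' b :
  rbc_map_fun (m + m') b = rbc_map_fun m b + rbc_map_fun m' b.
Proof. by rewrite /rbc_map_fun (raddfD phi) rscalerDl. Qed.
Fact rbc_map_funDr m b b' :
  rbc_map_fun m (b + b') = rbc_map_fun m b + rbc_map_fun m b'.
Proof. exact: rscalerDr. Qed.
Fact rbc_map_funA m (a : A) b :
  rbc_map_fun ((a : A^c) *: m) b = rbc_map_fun m (a *: b).
Proof. by rewrite /rbc_map_fun bimod_funZr rscalerA. Qed.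

Definition rbc_map_def : rbase_change f M -> rmod N :=
  tensor_lift (Balanced rbc_map_funDl rbc_map_funDr rbc_map_funA).

Lemma rbc_map_defE (m : rmod M) (b : lrestr f) :
  rbc_map_def (tens m b) = rscale (phi (m : M)) (b : B).
Proof. exact: tensor_liftE. Qed.

Fact rbc_map_zmod_morphism : zmod_morphism rbc_map_def.
Proof. by move=> x y; apply: raddfB. Qed.
HB.instance Definition _ := GRing.isZmodMorphism.Build (rbase_change f M)
  (rmod N) rbc_map_def rbc_map_zmod_morphism.
Fact rbc_map_scalable : scalable rbc_map_def.
Proof.
move=> c x; elim/rbc_ind: x => [|x y hx hy|m b].
- by rewrite scaler0 !raddf0.
- by rewrite scalerBr !rbc_map_zmod_morphism hx hy scalerBr.
- by rewrite [c *: _]rbc_scaleE !rbc_map_defE -rscalerA.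
Qed.
HB.instance Definition _ := GRing.isScalable.Build B^c (rbase_change f M)
  (rmod N) *:%R rbc_map_def rbc_map_scalable.

(* m (x) b |-> phi(m) . b *)
Definition rbc_map : {linear rbase_change f M -> rmod N} := rbc_map_def.

Definition lbc_map_fun (b : rrestr f) (m : M) : N := (b : B) *: phi m.
Fact lbc_map_funDl b b' m :
  lbc_map_fun (b + b') m = lbc_map_fun b m + lbc_map_fun b' m.
Proof. exact: scalerDl. Qed.
Fact lbc_map_funDr b m m' :
  lbc_map_fun b (m + m') = lbc_map_fun b m + lbc_map_fun b m'.
Proof. by rewrite /lbc_map_fun raddfD scalerDr. Qed.
Fact lbc_map_funA b (a : A) m :
  lbc_map_fun ((a : A^c) *: b) m = lbc_map_fun b (a *: m).
Proof. by rewrite /lbc_map_fun bimod_funZl scalerA. Qed.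

Definition lbc_map_def : lbase_change f M -> N :=
  tensor_lift (Balanced lbc_map_funDl lbc_map_funDr lbc_map_funA).

Lemma lbc_map_defE (b : rrestr f) (m : M) :
  lbc_map_def (tens b m) = (b : B) *: phi m.
Proof. exact: tensor_liftE. Qed.

Fact lbc_map_zmod_morphism : zmod_morphism lbc_map_def.
Proof. by move=> x y; apply: raddfB. Qed.
HB.instance Definition _ := GRing.isZmodMorphism.Build (lbase_change f M)
  N lbc_map_def lbc_map_zmod_morphism.
Fact lbc_map_scalable : scalable lbc_map_def.
Proof.
move=> c x; elim/lbc_ind: x => [|x y hx hy|b m].
- by rewrite scaler0 !raddf0.
- by rewrite scalerBr !lbc_map_zmod_morphism hx hy scalerBr.
- by rewrite [c *: _]lbc_scaleE !lbc_map_defE scalerA.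
Qed.
HB.instance Definition _ := GRing.isScalable.Build B (lbase_change f M)
  N *:%R lbc_map_def lbc_map_scalable.

(* b (x) m |-> b . phi(m) *)
Definition lbc_map : {linear lbase_change f M -> N} := lbc_map_def.

End NaturalMaps.

Record fp_glueing_datum (A1 A2 A12 : pzRingType)
    (j1 : {rmorphism A1 -> A12}) (j2 : {rmorphism A2 -> A12})
    (M1 : bimodType A1) (M2 : bimodType A2) (M12 : bimodType A12)
    (phi1 : bimodHom j1 M1 M12) (phi2 : bimodHom j2 M2 M12) : Prop := {
  glue_fp1 : finite_projective_bimod M1;
  glue_fp2 : finite_projective_bimod M2;
  glue_fp12 : finite_projective_bimod M12;
  glue_rbc1 : bijective (rbc_map phi1);
  glue_rbc2 : bijective (rbc_map phi2);
  glue_lbc1 : bijective (lbc_map phi1);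
  glue_lbc2 : bijective (lbc_map phi2)
}.

Section GlueKernel.
Variables (A A1 A2 A12 : pzRingType).
Variables (i1 : {rmorphism A -> A1}) (i2 : {rmorphism A -> A2}).
Variables (j1 : {rmorphism A1 -> A12}) (j2 : {rmorphism A2 -> A12}).
Variable comm : forall a, j1 (i1 a) = j2 (i2 a).
Variables (M1 : bimodType A1) (M2 : bimodType A2) (M12 : bimodType A12).
Variables (phi1 : bimodHom j1 M1 M12) (phi2 : bimodHom j2 M2 M12).

Definition glue_diff (p : M1 * M2) : M12 := phi1 p.1 - phi2 p.2.

Definition in_glue_ker : pred (M1 * M2) := fun p => glue_diff p == 0.

Fact glue_ker_zmod_closed : zmod_closed in_glue_ker.
Proof.
split; first by rewrite unfold_in /in_glue_ker /glue_diff subr_eq0 !raddf0.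
move=> p q; rewrite !unfold_in /in_glue_ker /glue_diff !subr_eq0.
by move=> /eqP pE /eqP qE; rewrite !raddfB /= pE qE.
Qed.
HB.instance Definition _ :=
  GRing.isZmodClosed.Build (M1 * M2)%type in_glue_ker glue_ker_zmod_closed.

(* The kernel of M1 (+) M2 -> M12.  Its type records comm, from which the
   A-bimodule structure is defined. *)
Record glue_ker (c : forall a, j1 (i1 a) = j2 (i2 a)) := GlueKer {
  glue_val :> M1 * M2;
  glue_valP : in_glue_ker glue_val
}.

Local Notation K := (glue_ker comm).

HB.instance Definition _ := [isSub for @glue_val comm].
HB.instance Definition _ := [Choice of K by <:].
HB.instance Definition _ := [SubChoice_isSubZmodule of K by <:].

Fact glue_lscale_subproof (a : A) (x : K) :
  in_glue_ker (i1 a *: (val x).1, i2 a *: (val x).2).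
Proof.
have /eqP := glue_valP x; rewrite /in_glue_ker /glue_diff => /subr0_eq xE.
by rewrite subr_eq0 /= !bimod_funZl xE comm.
Qed.
Definition glue_lscale a (x : K) : K := GlueKer comm (glue_lscale_subproof a x).

Fact glue_rscale_subproof (x : K) (a : A) :
  in_glue_ker (rscale (val x).1 (i1 a), rscale (val x).2 (i2 a)).
Proof.
have /eqP := glue_valP x; rewrite /in_glue_ker /glue_diff => /subr0_eq xE.
by rewrite subr_eq0 /= !bimod_funZr xE comm.
Qed.
Definition glue_rscale (x : K) a : K := GlueKer comm (glue_rscale_subproof x a).

Fact glue_lscalerA a b x :
  glue_lscale a (glue_lscale b x) = glue_lscale (a * b) x.
Proof. by apply: val_inj; rewrite /= !rmorphM !scalerA. Qed.
Fact glue_lscale1r : left_id 1 glue_lscale.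
Proof. by move=> [[x y] h]; apply: val_inj; rewrite /= !rmorph1 !scale1r. Qed.
Fact glue_lscalerDr : right_distributive glue_lscale +%R.
Proof. by move=> a x y; apply: val_inj; rewrite /= !scalerDr. Qed.
Fact glue_lscalerDl x : {morph glue_lscale^~ x : a b / a + b}.
Proof. by move=> a b; apply: val_inj; rewrite /= !rmorphD !scalerDl. Qed.
HB.instance Definition _ := GRing.Zmodule_isLmodule.Build A K
  glue_lscalerA glue_lscale1r glue_lscalerDr glue_lscalerDl.

Fact glue_rscalerA x a b :
  glue_rscale (glue_rscale x a) b = glue_rscale x (a * b).
Proof. by apply: val_inj; rewrite /= !rmorphM !rscalerA. Qed.
Fact glue_rscaler1 x : glue_rscale x 1 = x.
Proof.
by apply: val_inj; rewrite /= !rmorph1 !rscaler1; case: (glue_val x).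
Qed.
Fact glue_rscalerDl x y a :
  glue_rscale (x + y) a = glue_rscale x a + glue_rscale y a.
Proof. by apply: val_inj; rewrite /= !rscalerDl. Qed.
Fact glue_rscalerDr x a b :
  glue_rscale x (a + b) = glue_rscale x a + glue_rscale x b.
Proof. by apply: val_inj; rewrite /= !rmorphD !rscalerDr. Qed.
Fact glue_lrscalerA (a : A) (x : K) b :
  glue_rscale (a *: x) b = a *: glue_rscale x b.
Proof. by apply: val_inj; rewrite /= !lrscalerA. Qed.
HB.instance Definition _ := Lmodule_isBimodule.Build A K
  glue_rscalerA glue_rscaler1 glue_rscalerDl glue_rscalerDr glue_lrscalerA.

Definition glue_fst (x : K) : M1 := (glue_val x).1.
Definition glue_snd (x : K) : M2 := (glue_val x).2.

Fact glue_fst_zmod_morphism : zmod_morphism glue_fst.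
Proof. by []. Qed.
HB.instance Definition _ :=
  GRing.isZmodMorphism.Build K M1 glue_fst glue_fst_zmod_morphism.
Fact glue_snd_zmod_morphism : zmod_morphism glue_snd.
Proof. by []. Qed.
HB.instance Definition _ :=
  GRing.isZmodMorphism.Build K M2 glue_snd glue_snd_zmod_morphism.

Definition glue_pr1 : bimodHom i1 K M1 :=
  @BimodHom _ _ i1 K M1 glue_fst (fun _ _ => erefl) (fun _ _ => erefl).
Definition glue_pr2 : bimodHom i2 K M2 :=
  @BimodHom _ _ i2 K M2 glue_snd (fun _ _ => erefl) (fun _ _ => erefl).

End GlueKernel.

(* Main.v *)
(* Finite projectivity of a module is the existence of a dual basis: elements
   [x_j] and linear forms [g_j] with [m = sum_j g_j(m) x_j].  It suffices to find
   dual bases of [M_1] and [M_2] whose elements agree in [M_12] and whose linear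
   forms agree over [Pi_12]: by exactness they come from a dual basis of [M], and
   [m_1 |-> sum_j g_j(m_1) (x) x_j] inverts the base change map.

   Start from dual bases [(v, f_1)] of [M_1] and [(w, f_2)] of [M_2], and let [U], [U']
   be the transition matrices in [M_12]: [v = U w], [w = U' v].  The block matrix
   [W = [[1, U], [0, 1]] [[1, 0], [-U', 1]] [[1, U], [0, 1]]] satisfies
   [(f_1, 0) W = (0, f_2)] and [W (0; w) = (v; 0)].  Hence if [W = T_1 T_2] with [T_i]
   invertible over [Pi_i], the bases [T_1^-1 (v; 0)] and [T_2 (0; w)] are compatible.

   To factor [W], replace [U] and [U'] in it by approximations over [Pi_2]; this gives
   an invertible matrix [W'] over [Pi_2] with [W W'^-1] close to 1, and a matrix close
   to 1 factors by successive approximation, strictness bounding the corrections.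

   The right module structures are left module structures over the converse rings. *)
Require Import Defs.
From HB Require Import structures.
From mathcomp Require Import all_boot all_order all_algebra.
From mathcomp Require Import boolp classical_sets reals.
From mathcomp Require Import lra.

Set Implicit Arguments.
Unset Strict Implicit.
Unset Printing Implicit Defensive.
Import Order.TTheory GRing.Theory Num.Theory.
Local Open Scope ring_scope.

(** * Convergence in normed groups and Banach rings *)

Section NormedGroupTheory.
Variables (R : realType) (V W : normedGroupType R).
Implicit Types (x y z l m : V) (u v : nat -> V).

Lemma bnorm0 : bnorm (0 : V) = 0.
Proof. exact/bnorm_eq0. Qed.

Lemma bnorm_subC x y : bnorm (x - y) = bnorm (y - x).
Proof. by rewrite -bnormN opprB. Qed.

Lemma bnorm_sum (I : Type) (r : seq I) (F : I -> V) :
  bnorm (\sum_(i <- r) F i) <= \sum_(i <- r) bnorm (F i).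
Proof.
elim/big_ind2: _ => [|x a y b xa yb|//]; first by rewrite bnorm0.
by apply: le_trans (bnormD _ _) _; apply: lerD.
Qed.

Lemma bnorm_small x : (forall e : R, 0 < e -> bnorm x < e) -> x = 0.
Proof.
move=> small; apply/bnorm_eq0/eqP; rewrite eq_le bnorm_ge0 andbT leNgt.
by apply/negP => /small; rewrite ltxx.
Qed.

(** Since [N < 2 ^+ N], it suffices to take [N] above [K / e] by the Archimedean property. *)
Lemma half_exp_small (K e : R) : 0 < e -> exists N, K * 2^-1 ^+ N < e.
Proof.
move=> e0; pose N := Num.bound `|K / e|; exists N.
have KN : K / e < N%:R.
  by apply: le_lt_trans (ler_norm _) _; apply: archi_boundP; rewrite normr_ge0.
have N2 : (N%:R : R) < 2 ^+ N by rewrite -natrX ltr_nat ltn_expl.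
rewrite exprVn ltr_pdivrMr ?exprn_gt0 // mulrC -ltr_pdivrMr //.
exact: lt_trans KN N2.
Qed.

Lemma half_exp_ge0 n : 0 <= 2^-1 ^+ n :> R.
Proof. by rewrite exprn_ge0 // invr_ge0. Qed.

Lemma geometric_cauchy u (K : R) :
  (forall n, bnorm (u n.+1 - u n) <= K * 2^-1 ^+ n) -> cauchy_seq u.
Proof.
move=> uK.
(* The last factor is the exact value of the sum of [2^-1 ^+ i] over [i < d], so that the induction
   on [d] closes. *)
have ud n d : bnorm (u (n + d)%N - u n) <= K * 2^-1 ^+ n * (2 - 2 * 2^-1 ^+ d).
  elim: d => [|d IHd]; first by rewrite addn0 subrr bnorm0 expr0 mulr1 subrr mulr0.
  rewrite addnS -(subrKA (u (n + d)%N)).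
  apply: le_trans (bnormD _ _) _; apply: le_trans (lerD (uK _) IHd) _.
  by rewrite exprD exprS; lra.
have K0 : 0 <= K by apply: le_trans (bnorm_ge0 _) (le_trans (uK 0) _); rewrite mulr1.
move=> e e0; have [N Ne] := half_exp_small (4 * K) e0; exists N => m n Nm Nn.
have uN i : (N <= i)%N -> bnorm (u i - u N) <= 2 * K * 2^-1 ^+ N.
  move=> /subnKC <-; apply: le_trans (ud _ _) _.
  have := half_exp_ge0 N; have := half_exp_ge0 (i - N).
  move: (2^-1 ^+ N) (2^-1 ^+ (i - N)) => s t t0 s0; have := mulr_ge0 K0 s0.
  by move: (K * s) (mulrA 2 K s) => q qE q0; rewrite -qE; nra.
rewrite -(subrKA (u N)).
apply: le_lt_trans (bnormD _ _) _; rewrite (bnorm_subC (u N)).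
by apply: le_lt_trans (lerD (uN _ Nm) (uN _ Nn)) _; lra.
Qed.

Lemma converges_geometric u l (K : R) :
  (forall n, bnorm (u n - l) <= K * 2^-1 ^+ n) -> converges_to u l.
Proof.
move=> uK e e0; have [N Ne] := half_exp_small K e0; exists N => n Nn.
apply: le_lt_trans (uK n) _; apply: le_lt_trans Ne.
have K0 : 0 <= K by apply: le_trans (bnorm_ge0 _) (le_trans (uK 0) _); rewrite mulr1.
by apply: ler_wpM2l => //; apply: ler_wiXn2l => //; lra.
Qed.

Lemma converges_cst l : converges_to (fun=> l) l.
Proof. by move=> e e0; exists 0%N => n _; rewrite subrr bnorm0. Qed.

Lemma convergesD u v l m : converges_to u l -> converges_to v m ->
  converges_to (fun n => u n + v n) (l + m).
Proof.
move=> ul vm e e0; have e2 : 0 < e / 2 by rewrite divr_gt0.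
have [N uN] := ul _ e2; have [N' vN] := vm _ e2; exists (maxn N N') => n.
rewrite geq_max => /andP[Nn N'n]; rewrite opprD addrACA.
apply: le_lt_trans (bnormD _ _) _.
by have := uN _ Nn; have := vN _ N'n; lra.
Qed.

Lemma converges_unique u l m : converges_to u l -> converges_to u m -> l = m.
Proof.
move=> ul um; apply/subr0_eq/bnorm_small => e e0.
have e2 : 0 < e / 2 by rewrite divr_gt0.
have [N uN] := ul _ e2; have [N' uN'] := um _ e2.
have := uN _ (leq_maxl N N'); have := uN' _ (leq_maxr N N').
rewrite -(subrKA (u (maxn N N'))) (bnorm_subC _ l) => a b.
by apply: le_lt_trans (bnormD _ _) _; lra.
Qed.

Lemma converges_bnorm_le u l (c : R) :
  converges_to u l -> (forall n, bnorm (u n) <= c) -> bnorm l <= c.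
Proof.
move=> ul uc; rewrite leNgt; apply/negP => cl.
have [N uN] := ul (bnorm l - c) ltac:(by rewrite subr_gt0).
have := bnormD (u N) (l - u N); rewrite addrC subrK (bnorm_subC l).
by have := uN _ (leqnn N); have := uc N; lra.
Qed.

Lemma converges_eventually_bounded u l :
  converges_to u l -> exists N, forall n, (N <= n)%N -> bnorm (u n) <= bnorm l + 1.
Proof.
move=> ul; have [N uN] := ul 1 ltr01; exists N => n Nn.
have := bnormD (u n - l) l; rewrite subrK; by have := uN _ Nn; lra.
Qed.

(** The constant is raised to at least 1 so that it can be divided by and so that products of such
    constants stay at least 1. *)
Lemma norm_boundedW (f : V -> W) :
  norm_bounded f -> exists2 D : R, 1 <= D & forall x, bnorm (f x) <= D * bnorm x.
Proof.
move=> [C fC]; exists (Num.max 1 C); first by rewrite le_max lexx.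
move=> x; apply: le_trans (fC x) _; apply: ler_wpM2r; first exact: bnorm_ge0.
by rewrite le_max lexx orbT.
Qed.

Lemma converges_bounded (f : {additive V -> W}) u l :
  norm_bounded f -> converges_to u l -> converges_to (f \o u) (f l).
Proof.
move=> /norm_boundedW[D D1 fD] ul e e0.
have D0 : 0 < D by apply: lt_le_trans D1.
have [N uN] := ul (e / D) ltac:(by rewrite divr_gt0).
exists N => n /uN; rewrite ltr_pdivlMr // mulrC; apply: le_lt_trans.
by rewrite /= -raddfB.
Qed.

End NormedGroupTheory.

Definition invertible (S : pzRingType) (u : S) : Prop :=
  exists v, u * v = 1 /\ v * u = 1.

Section InvertibleTheory.
Variable S : pzRingType.
Implicit Types u v : S.

Lemma invertibleM u v : invertible u -> invertible v -> invertible (u * v).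
Proof.
move=> [u' [uu' u'u]] [v' [vv' v'v]]; exists (v' * u'); split.
  by rewrite mulrA -(mulrA u) vv' mulr1.
by rewrite mulrA -(mulrA v') u'u mulr1.
Qed.

End InvertibleTheory.

Section BanachRingTheory.
Variables (R : realType) (S : banachRingType R).
Implicit Types (x y z l m : S) (u v : nat -> S).

Lemma bnormM_le x y (a b : R) :
  bnorm x <= a -> bnorm y <= b -> bnorm (x * y) <= a * b.
Proof.
by move=> xa yb; apply: le_trans (bnormM _ _) _; rewrite ler_pM ?bnorm_ge0.
Qed.

Lemma convergesM u v l m : converges_to u l -> converges_to v m ->
  converges_to (fun n => u n * v n) (l * m).
Proof.
move=> ul vm e e0; have [N0 uB] := converges_eventually_bounded ul.
(* [B] exceeds both [bnorm m] and the eventual bound [bnorm l + 1] of [u], which are the cofactors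
   in the splitting of [u n * v n - l * m] below. *)
pose B := bnorm l + bnorm m + 2.
have B0 : 0 < B by rewrite /B; have := bnorm_ge0 l; have := bnorm_ge0 m; lra.
have e2 : 0 < e / (2 * B) by rewrite divr_gt0 // mulr_gt0.
have [N1 uN] := ul _ e2; have [N2 vN] := vm _ e2.
exists (maxn N0 (maxn N1 N2)) => n; rewrite !geq_max => /and3P[n0 n1 n2].
have -> : u n * v n - l * m = u n * (v n - m) + (u n - l) * m.
  by rewrite mulrBr mulrBl subrKA.
apply: le_lt_trans (bnormD _ _) _.
have := bnormM (u n) (v n - m); have := bnormM (u n - l) m.
have := uN _ n1; have := vN _ n2; have := uB _ n0.
rewrite !ltr_pdivlMr ?mulr_gt0 //.
have := bnorm_ge0 (u n); have := bnorm_ge0 (v n - m); have := bnorm_ge0 m.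
have := bnorm_ge0 (u n - l); have := bnorm_ge0 l; rewrite /B.
move: (bnorm (u n)) (bnorm (v n - m)) (bnorm (u n - l)) (bnorm l) (bnorm m).
by move=> a b c d f; nra.
Qed.

(** The factor [bnorm 1] serves the case [n = 0]: the norm of the unit is not normalized. *)
Lemma bnormX x n : bnorm (x ^+ n) <= bnorm (1 : S) * bnorm x ^+ n.
Proof.
elim: n => [|n IHn]; first by rewrite !expr0 mulr1.
by rewrite !exprSr mulrA; apply: bnormM_le.
Qed.

(** The inverse is the sum of the geometric series of [x]. Its partial sums multiply with [1 - x] to
    [1 - x ^+ n] on either side, and these products tend to 1. *)
Lemma neumann x : bnorm x <= 2^-1 -> invertible (1 - x).
Proof.
move=> x2; pose u n := \sum_(i < n) x ^+ i.
have pow n : bnorm (x ^+ n) <= bnorm (1 : S) * 2^-1 ^+ n.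
  apply: le_trans (bnormX x n) _; apply: ler_wpM2l; first exact: bnorm_ge0.
  by apply: lerXn2r; rewrite // nnegrE ?bnorm_ge0 // invr_ge0.
have uS n : bnorm (u n.+1 - u n) <= bnorm (1 : S) * 2^-1 ^+ n.
  by rewrite /u big_ord_recr /= [_ + x ^+ n]addrC addrK.
have [l ul] := bnorm_complete _ (geometric_cauchy uS).
have lim1 : converges_to (fun n => 1 - x ^+ n) (1 : S).
  by apply: (@converges_geometric _ _ _ _ (bnorm (1 : S))) => n; rewrite addrC addKr bnormN.
have u1 n : (1 - x) * u n = 1 - x ^+ n.
  by rewrite /u -opprB mulNr -subrX1 opprB.
have u2 n : u n * (1 - x) = 1 - x ^+ n.
  rewrite -u1 /u mulr_suml mulr_sumr; apply: eq_bigr => i _.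
  by rewrite mulrBl mulrBr mulr1 mul1r -exprS -exprSr.
exists l; split; apply: converges_unique lim1.
  by rewrite -(funext u1); apply: convergesM => //; apply: converges_cst.
by rewrite -(funext u2); apply: convergesM => //; apply: converges_cst.
Qed.

End BanachRingTheory.

(** * Factorization near the identity *)

(** This is the form in which strictness is used: the difference map has lifts of linearly bounded
    norm. The sign of the second component is absorbed in the lift. *)
Definition bounded_splitting (R : realType) (V1 V2 W : normedGroupType R)
    (f : V1 -> W) (g : V2 -> W) : Prop :=
  exists C : R, forall w, exists p : V1 * V2,
    [/\ w = f p.1 + g p.2, bnorm p.1 <= C * bnorm w & bnorm p.2 <= C * bnorm w].

Section Factorization.
Variables (R : realType) (S1 S2 S12 : banachRingType R).
Variables (j1 : {rmorphism S1 -> S12}) (j2 : {rmorphism S2 -> S12}).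
Hypotheses (j1_bounded : norm_bounded j1) (j2_bounded : norm_bounded j2).
Hypothesis split12 : bounded_splitting j1 j2.
Hypothesis dense2 : dense_image j2.

(** The factors are [1 + x] and [1 + y], with [x] and [y] limits of a successive approximation.
    Completeness gives the limits, and their smallness makes both factors invertible by the Neumann
    series. *)
Lemma near_one_factor : exists2 e : R, 0 < e &
  forall w : S12, bnorm w <= e ->
    exists u1 u2, [/\ invertible u1, invertible u2 & 1 + w = j1 u1 * j2 u2].
Proof.
have [D1 D1_ge1 j1D] := norm_boundedW j1_bounded.
have [D2 D2_ge1 j2D] := norm_boundedW j2_bounded.
have [C0 spl0] := split12; pose C := Num.max 1 C0.
have C_ge1 : 1 <= C by rewrite le_max lexx.
have /choice[h hP] : forall w, exists p : S1 * S2,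
    [/\ w = j1 p.1 + j2 p.2, bnorm p.1 <= C * bnorm w & bnorm p.2 <= C * bnorm w].
  move=> w; have [p [wE p1 p2]] := spl0 w; exists p.
  have CC : C0 * bnorm w <= C * bnorm w.
    by apply: ler_wpM2r; rewrite ?bnorm_ge0 // le_max lexx orbT.
  by split=> //; apply: le_trans CC.
pose D := D1 * D2.
have D_ge1 : 1 <= D by rewrite mulr_ege1.
(* The three terms of the new residual add up to at most [5 * D * C ^+ 2 * rho] times the old one,
   and 10 turns this into one half. As [D * C >= 1], it also gives [C * rho <= 10^-1]. *)
pose rho := (10 * D * C ^+ 2)^-1.
have DC_gt0 : 0 < 10 * D * C ^+ 2.
  have D_gt0 := lt_le_trans ltr01 D_ge1; have C_gt0 := lt_le_trans ltr01 C_ge1.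
  by rewrite pmulr_rgt0 ?exprn_gt0 // mulr_gt0 // ltr0n.
have rho_gt0 : 0 < rho by rewrite invr_gt0.
have rhoE : 10 * D * C ^+ 2 * rho = 1 by rewrite mulfV // gt_eqF.
exists rho => // w w_le.
(* [(x, y)] is corrected by a lift [(a, b)] of its residual [r]; the new residual
   [- (a y + x b + a b)] is at most half of [r] while [x], [y], [r] stay within
   [2 C rho], [2 C rho], [rho], and these bounds persist along the iteration. *)
pose r (p : S1 * S2) := 1 + w - (1 + j1 p.1) * (1 + j2 p.2).
pose step (p : S1 * S2) : S1 * S2 := p + h (r p).
pose p n := iter n step 0.
have rS q : r (step q) =
    - (j1 (h (r q)).1 * j2 q.2 + j1 q.1 * j2 (h (r q)).2
       + j1 (h (r q)).1 * j2 (h (r q)).2).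
  have [rE _ _] := hP (r q); move: rE; rewrite [r (step q)]/r /=.
  move: (h (r q)) => [a b] /= rE; rewrite !rmorphD /=.
  have -> : 1 + w = (1 + j1 q.1) * (1 + j2 q.2) + (j1 a + j2 b).
    by rewrite -rE /r [RHS]addrC subrK.
  have -> : (1 + (j1 q.1 + j1 a)) * (1 + (j2 q.2 + j2 b)) =
      (1 + j1 q.1) * (1 + j2 q.2) + (j1 a + j2 b)
      + (j1 a * j2 q.2 + j1 q.1 * j2 b + j1 a * j2 b).
    rewrite !addrA (mulrDl (1 + _)) !(mulrDr _ (1 + j2 q.2)).
    rewrite (mulrDr (j1 a) 1) mulr1 (mulrDl 1 _ (j2 b)) mul1r.
    by rewrite !addrA [LHS](ACl (1*4*2*5*3*6)).
  by rewrite opprD addrA subrr add0r.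
have rS_le q : bnorm q.1 <= 2 * C * rho -> bnorm q.2 <= 2 * C * rho ->
    bnorm (r q) <= rho -> bnorm (r (step q)) <= 2^-1 * bnorm (r q).
  move=> q1 q2 r_le; have [_ h1 h2] := hP (r q); rewrite rS bnormN.
  apply: le_trans (bnormD _ _) _; apply: le_trans (lerD (bnormD _ _) (lexx _)) _.
  apply: le_trans (lerD (lerD _ _) _) _.
  - apply: (@bnormM_le _ _ _ _ (D1 * (C * bnorm (r q))) (D2 * (2 * C * rho))).
      by apply: le_trans (j1D _) _; rewrite ler_wpM2l // (le_trans ler01).
    by apply: le_trans (j2D _) _; rewrite ler_wpM2l // (le_trans ler01).
  - apply: (@bnormM_le _ _ _ _ (D1 * (2 * C * rho)) (D2 * (C * bnorm (r q)))).
      by apply: le_trans (j1D _) _; rewrite ler_wpM2l // (le_trans ler01).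
    by apply: le_trans (j2D _) _; rewrite ler_wpM2l // (le_trans ler01).
  (* This term is quadratic in the residual. One of its two factors is bounded through [rho], so
     that the estimate stays linear in [bnorm (r q)]. *)
  - apply: (@bnormM_le _ _ _ _ (D1 * (C * bnorm (r q))) (D2 * (C * rho))).
      by apply: le_trans (j1D _) _; rewrite ler_wpM2l // (le_trans ler01).
    apply: le_trans (j2D _) _; rewrite ler_wpM2l // ?(le_trans ler01) //.
    by apply: le_trans h2 _; rewrite ler_wpM2l // (le_trans ler01).
  suff -> : D1 * (C * bnorm (r q)) * (D2 * (2 * C * rho))
     + D1 * (2 * C * rho) * (D2 * (C * bnorm (r q)))
     + D1 * (C * bnorm (r q)) * (D2 * (C * rho))
     = 2^-1 * bnorm (r q) * (10 * D * C ^+ 2 * rho) by rewrite rhoE mulr1.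
  by rewrite /D; lra.
(* The increments of both components are at most [C * rho * 2^-1 ^+ i]; summed over [i < n] they
   give the stated bounds, which never exceed [2 * C * rho]. *)
have inv n : [/\ bnorm (r (p n)) <= rho * 2^-1 ^+ n,
    bnorm (p n).1 <= 2 * C * rho * (1 - 2^-1 ^+ n) &
    bnorm (p n).2 <= 2 * C * rho * (1 - 2^-1 ^+ n)].
  elim: n => [|n [rn pn1 pn2]].
    rewrite /= expr0 mulr1 subrr mulr0 !bnorm0 /r !raddf0 !addr0 mulr1.
    by rewrite [1 + w]addrC addrK.
  have Crho : 0 <= 2 * C * rho.
    by rewrite !mulr_ge0 // ?(ltW rho_gt0) // (le_trans ler01).
  have half0 := half_exp_ge0 R n.
  have le1 (x : R) : x <= 2 * C * rho * (1 - 2^-1 ^+ n) -> x <= 2 * C * rho.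
    by move=> /le_trans; apply; rewrite ler_piMr // lerBlDr lerDl.
  have r_le : bnorm (r (p n)) <= rho.
    by apply: le_trans rn _; rewrite ler_piMr ?(ltW rho_gt0) // exprn_ile1 //; lra.
  have [_ h1 h2] := hP (r (p n)).
  have C_le : C * bnorm (r (p n)) <= C * (rho * 2^-1 ^+ n).
    by rewrite ler_wpM2l // (le_trans ler01).
  split=> [|/=|/=]; rewrite exprS.
  - by apply: le_trans (rS_le _ (le1 _ pn1) (le1 _ pn2) r_le) _; lra.
  - by apply: le_trans (bnormD _ _) _; lra.
  - by apply: le_trans (bnormD _ _) _; lra.
have step1 n : bnorm ((p n.+1).1 - (p n).1) <= C * rho * 2^-1 ^+ n.
  rewrite [(p n.+1).1]/= [_ + (h _).1]addrC addrK.
  have [_ h1 _] := hP (r (p n)); apply: le_trans h1 _.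
  by rewrite -mulrA ler_wpM2l ?(le_trans ler01) //; case: (inv n).
have step2 n : bnorm ((p n.+1).2 - (p n).2) <= C * rho * 2^-1 ^+ n.
  rewrite [(p n.+1).2]/= [_ + (h _).2]addrC addrK.
  have [_ _ h2] := hP (r (p n)); apply: le_trans h2 _.
  by rewrite -mulrA ler_wpM2l ?(le_trans ler01) //; case: (inv n).
have [x xP] := bnorm_complete _ (geometric_cauchy step1).
have [y yP] := bnorm_complete _ (geometric_cauchy step2).
(* This keeps the limits within the radius of [neumann]. *)
have small n : 2 * C * rho * (1 - 2^-1 ^+ n) <= 2^-1.
  have := half_exp_ge0 R n; set t := 2^-1 ^+ n => t0.
  have Crho : C * rho <= 10^-1.
    have : 1 <= D * C by rewrite mulr_ege1.
    have : 0 <= C * rho by rewrite mulr_ge0 ?(ltW rho_gt0) // (le_trans ler01).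
    have -> : 10^-1 = D * C * (C * rho) by move: rhoE; lra.
    by move=> Crho0 DC; rewrite ler_peMl.
  have Crho0 : 0 <= C * rho by rewrite mulr_ge0 ?(ltW rho_gt0) // (le_trans ler01).
  have := mulr_ge0 Crho0 t0; move: Crho; rewrite mulrBr mulr1 -!mulrA.
  by lra.
have x_le : bnorm x <= 2^-1.
  by apply: (converges_bnorm_le xP) => n; case: (inv n) => _ /le_trans + _; apply.
have y_le : bnorm y <= 2^-1.
  by apply: (converges_bnorm_le yP) => n; case: (inv n) => _ _ /le_trans; apply.
exists (1 + x), (1 + y); split.
- by rewrite -(opprK x); apply: neumann; rewrite bnormN.
- by rewrite -(opprK y); apply: neumann; rewrite bnormN.
rewrite !rmorphD !rmorph1.
(* The residuals tend to 0, so the same sequence of products also converges to [1 + w]; uniqueness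
   of limits concludes. *)
have lim : converges_to (fun n => (1 + j1 (p n).1) * (1 + j2 (p n).2))
    ((1 + j1 x) * (1 + j2 y)).
  apply: convergesM; apply: convergesD; do ?exact: converges_cst.
    exact: (converges_bounded j1_bounded xP).
  exact: (converges_bounded j2_bounded yP).
apply: converges_unique lim; apply: (@converges_geometric _ _ _ _ rho) => n.
by rewrite bnorm_subC; case: (inv n).
Qed.

(** Closeness to the image of a unit [v] is measured multiplicatively, since [g * j2 v' - 1] is the
    perturbation to which [near_one_factor] applies. Units of [S2] are demanded, not mere elements:
    density alone would not provide them. *)
Definition unit_approximable (g : S12) : Prop :=
  forall e : R, 0 < e -> exists v v' : S2,
    [/\ v * v' = 1, v' * v = 1 & bnorm (g * j2 v' - 1) < e].

(** The unit for [g] is chosen first; the tolerance for [g'] then depends on it, because the error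
    of [g'] gets multiplied by [g] on the left and by [j2 v'] on the right. *)
Lemma unit_approximableM g g' :
  unit_approximable g -> unit_approximable g' -> unit_approximable (g * g').
Proof.
move=> ga g'a e e0; have e2 : 0 < e / 2 by rewrite divr_gt0.
have [v [v' [vv' v'v gv]]] := ga _ e2.
pose B := bnorm g * bnorm (j2 v') + 1.
have B0 : 0 < B by rewrite ltr_wpDl // mulr_ge0 // bnorm_ge0.
have [u [u' [uu' u'u gu]]] := g'a (e / 2 / B) ltac:(by rewrite divr_gt0).
exists (v * u), (u' * v'); split.
- by rewrite mulrA -(mulrA v) uu' mulr1.
- by rewrite mulrA -(mulrA u') v'v mulr1.
have -> : g * g' * j2 (u' * v') - 1 =
    g * (g' * j2 u' - 1) * j2 v' + (g * j2 v' - 1).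
  by rewrite rmorphM mulrBr mulrBl mulr1 !mulrA subrKA.
apply: le_lt_trans (bnormD _ _) _.
suff : bnorm (g * (g' * j2 u' - 1) * j2 v') <= e / 2 by lra.
apply: le_trans (bnormM _ _) _; apply: le_trans (ler_wpM2r (bnorm_ge0 _) (bnormM _ _)) _.
move: gu; rewrite ltr_pdivlMr // /B.
have := bnorm_ge0 (g' * j2 u' - 1).
have : 0 <= bnorm g * bnorm (j2 v') by rewrite mulr_ge0 ?bnorm_ge0.
rewrite mulrAC; move: (bnorm g * bnorm (j2 v')) (bnorm (g' * _ - 1)) => a b.
by nra.
Qed.

(** The element [g * j2 v'] is close enough to 1 to factor, and the unit [v] is then absorbed into
    the second factor. *)
Lemma unit_approximable_factor g : unit_approximable g ->
  exists u1 u2, [/\ invertible u1, invertible u2 & g = j1 u1 * j2 u2].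
Proof.
have [e e0 fac] := near_one_factor.
move=> /(_ e e0)[v [v' [vv' v'v /ltW/fac[u1 [u2 [u1i u2i]]]]]].
rewrite addrC subrK => gE; exists u1, (u2 * v); split=> //.
  by apply: invertibleM => //; exists v'.
by rewrite rmorphM mulrA -gE -mulrA -rmorphM v'v rmorph1 mulr1.
Qed.

End Factorization.

(** * Matrices over Banach rings *)

Section MatrixNorm.
Variables (R : realType) (V : normedGroupType R) (m n : nat).
Implicit Types X Y : 'M[V]_(m, n).

(** Summing over the entries, rather than taking a maximum, makes the norm of square matrices
    submultiplicative with no constant depending on the size. *)
Definition mx_bnorm X : R := \sum_i \sum_j bnorm (X i j).

Lemma le_mx_bnorm X i j : bnorm (X i j) <= mx_bnorm X.
Proof.
rewrite /mx_bnorm (bigD1 i) //= (bigD1 j) //= -addrA lerDl.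
apply: addr_ge0; apply: sumr_ge0 => i' _; first exact: bnorm_ge0.
by apply: sumr_ge0 => j' _; apply: bnorm_ge0.
Qed.

Lemma mx_bnorm_eq0 X : mx_bnorm X = 0 <-> X = 0.
Proof.
split=> [X0 | ->]; last by apply: big1 => i _; apply: big1 => j _; rewrite mxE bnorm0.
apply/matrixP => i j; rewrite mxE; apply/bnorm_eq0/eqP.
by rewrite eq_le bnorm_ge0 -X0 le_mx_bnorm.
Qed.

Lemma mx_bnormN X : mx_bnorm (- X) = mx_bnorm X.
Proof. by apply: eq_bigr => i _; apply: eq_bigr => j _; rewrite mxE bnormN. Qed.

Lemma mx_bnormD X Y : mx_bnorm (X + Y) <= mx_bnorm X + mx_bnorm Y.
Proof.
rewrite -big_split; apply: ler_sum => i _; rewrite -big_split.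
by apply: ler_sum => j _; rewrite mxE bnormD.
Qed.

HB.instance Definition _ := isNormedGroup.Build R 'M[V]_(m, n)
  mx_bnorm_eq0 mx_bnormN mx_bnormD.

Lemma mx_bnormE X : bnorm X = \sum_i \sum_j bnorm (X i j).
Proof. by []. Qed.

Lemma mx_norm_complete : norm_complete V -> norm_complete 'M[V]_(m, n).
Proof.
move=> complV u u_cauchy.
have entry_cauchy i j : cauchy_seq (fun k => u k i j).
  move=> e /u_cauchy[N uN]; exists N => k l Nk Nl.
  apply: le_lt_trans (uN k l Nk Nl); apply: le_trans (le_mx_bnorm _ i j).
  by rewrite !mxE.
have /choice[L LP] : forall ij : 'I_m * 'I_n,
    exists l, converges_to (fun k => u k ij.1 ij.2) l.
  by move=> [i j]; apply: complV (entry_cauchy i j).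
exists (\matrix_(i, j) L (i, j)) => e e0.
(* The successor makes the sum of the [m * n] entry bounds strictly less than [e], and avoids a
   division by 0 for empty matrices. *)
pose d := e / (m * n).+1%:R.
have d0 : 0 < d by rewrite divr_gt0 // ltr0n.
have /choice[N NP] : forall ij : 'I_m * 'I_n, exists N, forall k, (N <= k)%N ->
    bnorm (u k ij.1 ij.2 - L ij) < d.
  by move=> ij; apply: LP.
exists (\max_ij N ij) => k kN; rewrite mx_bnormE.
apply: (@le_lt_trans _ _ (\sum_(i < m) \sum_(j < n) d)).
  apply: ler_sum => i _; apply: ler_sum => j _; rewrite !mxE; apply/ltW/(NP (i, j)).
  exact: leq_trans (leq_bigmax (i, j)) kN.
rewrite !sumr_const !card_ord -mulrnA -mulr_natr mulnC /d.
by rewrite mulrAC ltr_pdivrMr ?ltr0n // ltr_pM2l // ltr_nat.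
Qed.

End MatrixNorm.

Section MatrixBanachRing.
Variables (R : realType) (A : banachRingType R) (n : nat).

Lemma mx_bnormM (X Y : 'M[A]_n) : bnorm (X * Y) <= bnorm X * bnorm Y.
Proof.
rewrite !mx_bnormE mulr_suml; apply: ler_sum => i _.
apply: (@le_trans _ _ (\sum_k \sum_j bnorm (X i j) * bnorm (Y j k))).
  apply: ler_sum => k _; rewrite mxE; apply: le_trans (bnorm_sum _ _) _.
  by apply: ler_sum => j _; apply: bnormM.
rewrite exchange_big mulr_suml; apply: ler_sum => j _ /=; rewrite -mulr_sumr.
apply: ler_wpM2l; first exact: bnorm_ge0.
rewrite [leRHS](bigD1 j) //= lerDl; apply: sumr_ge0 => i' _.
by apply: sumr_ge0 => k _; apply: bnorm_ge0.
Qed.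

HB.instance Definition _ := NormedGroup_isBanachRing.Build R 'M[A]_n
  mx_bnormM (mx_norm_complete bnorm_complete).

End MatrixBanachRing.

Section MatrixMap.
Variables (R : realType) (V W : normedGroupType R) (f : V -> W) (m n : nat).

Lemma map_mx_norm_bounded :
  norm_bounded f -> norm_bounded (map_mx f : 'M_(m, n) -> 'M_(m, n)).
Proof.
move=> [C fC]; exists C => X; rewrite !mx_bnormE mulr_sumr.
by apply: ler_sum => i _; rewrite mulr_sumr; apply: ler_sum => j _; rewrite mxE.
Qed.

Lemma map_mx_dense_image :
  dense_image f -> dense_image (map_mx f : 'M_(m, n) -> 'M_(m, n)).
Proof.
move=> f_dense Y e e0; pose d := e / (m * n).+1%:R.
have d0 : 0 < d by rewrite divr_gt0 // ltr0n.
have /choice[X XP] : forall ij : 'I_m * 'I_n, exists x, bnorm (Y ij.1 ij.2 - f x) < d.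
  by move=> ij; apply: f_dense.
exists (\matrix_(i, j) X (i, j)); rewrite mx_bnormE.
apply: (@le_lt_trans _ _ (\sum_(i < m) \sum_(j < n) d)).
  by apply: ler_sum => i _; apply: ler_sum => j _; rewrite !mxE; apply/ltW/(XP (i, j)).
rewrite !sumr_const !card_ord -mulrnA -mulr_natr mulnC /d.
by rewrite mulrAC ltr_pdivrMr ?ltr0n // ltr_pM2l // ltr_nat.
Qed.

End MatrixMap.

(** Entries are split one by one; the constant is unchanged because the norms add up over the
    entries. *)
Lemma map_mx_bounded_splitting (R : realType) (V1 V2 W : normedGroupType R)
    (f : V1 -> W) (g : V2 -> W) m n : bounded_splitting f g ->
  bounded_splitting (map_mx f : 'M_(m, n) -> _) (map_mx g : 'M_(m, n) -> _).
Proof.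
move=> [C /choice[h hP]]; exists C => X.
exists (map_mx (fun w => (h w).1) X, map_mx (fun w => (h w).2) X); split=> /=.
- by apply/matrixP => i j; rewrite !mxE; case: (hP (X i j)).
- rewrite !mx_bnormE mulr_sumr; apply: ler_sum => i _; rewrite mulr_sumr.
  by apply: ler_sum => j _; rewrite mxE; case: (hP (X i j)).
- rewrite !mx_bnormE mulr_sumr; apply: ler_sum => i _; rewrite mulr_sumr.
  by apply: ler_sum => j _; rewrite mxE; case: (hP (X i j)).
Qed.

Lemma bnorm_block_mx (R : realType) (V : normedGroupType R) m1 m2 n1 n2
    (X : 'M[V]_(m1, n1)) (Y : 'M_(m1, n2)) (Z : 'M_(m2, n1)) (T : 'M_(m2, n2)) :
  bnorm (block_mx X Y Z T) = bnorm X + bnorm Y + (bnorm Z + bnorm T).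
Proof.
rewrite !mx_bnormE big_split_ord /=; congr (_ + _); rewrite -big_split;
  apply: eq_bigr => i _; rewrite big_split_ord /=; congr (_ + _);
  apply: eq_bigr => j _.
- by rewrite block_mxEul.
- by rewrite block_mxEur.
- by rewrite block_mxEdl.
- by rewrite block_mxEdr.
Qed.

(** * Block transvections and their factorization *)

Section Transvections.
Variables (A : pzRingType) (n1 n2 : nat).

Definition utransv (U : 'M[A]_(n1, n2)) : 'M_(n1 + n2) := block_mx 1%:M U 0 1%:M.
Definition ltransv (U : 'M[A]_(n2, n1)) : 'M_(n1 + n2) := block_mx 1%:M 0 U 1%:M.

Lemma utransvM U U' : utransv U * utransv U' = utransv (U' + U).
Proof.
by rewrite /utransv -mulmxE mulmx_block !mul1mx !mulmx1 !mulmx0 !mul0mx !addr0 !add0r.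
Qed.

Lemma ltransvM U U' : ltransv U * ltransv U' = ltransv (U + U').
Proof.
by rewrite /ltransv -mulmxE mulmx_block !mul1mx !mulmx1 !mulmx0 !mul0mx !addr0 !add0r.
Qed.

Lemma utransv_sub1 U : utransv U - 1 = block_mx 0 U 0 0.
Proof.
by rewrite /utransv -idmxE scalar_mx_block opp_block_mx add_block_mx !subrr !subr0.
Qed.

Lemma ltransv_sub1 U : ltransv U - 1 = block_mx 0 0 U 0.
Proof.
by rewrite /ltransv -idmxE scalar_mx_block opp_block_mx add_block_mx !subrr !subr0.
Qed.

Lemma utransv0 : utransv 0 = 1.
Proof. by rewrite /utransv -scalar_mx_block. Qed.

Lemma ltransv0 : ltransv 0 = 1.
Proof. by rewrite /ltransv -scalar_mx_block. Qed.

End Transvections.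

Lemma map_utransv (A B : pzRingType) (f : {rmorphism A -> B}) n1 n2 U :
  map_mx f (@utransv A n1 n2 U) = utransv (map_mx f U).
Proof. by rewrite /utransv map_block_mx !map_mx1 map_mx0. Qed.

Lemma map_ltransv (A B : pzRingType) (f : {rmorphism A -> B}) n1 n2 U :
  map_mx f (@ltransv A n1 n2 U) = ltransv (map_mx f U).
Proof. by rewrite /ltransv map_block_mx !map_mx1 map_mx0. Qed.

(** All that the construction of dual bases needs from analysis. Being purely algebraic, it can be
    applied to the rings and to their converses alike. *)
Definition factors_transvections (A1 A2 A12 : pzRingType)
    (j1 : {rmorphism A1 -> A12}) (j2 : {rmorphism A2 -> A12}) : Prop :=
  forall n1 n2 (U : 'M[A12]_(n1, n2)) (U' : 'M[A12]_(n2, n1)),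
    exists (T1 : 'M[A1]_(n1 + n2)) (T2 : 'M[A2]_(n1 + n2)),
    [/\ invertible T1, invertible T2 &
      utransv U * ltransv (- U') * utransv U = map_mx j1 T1 * map_mx j2 T2].

Section TransvectionFactorization.
Variables (R : realType) (A1 A2 A12 : banachRingType R).
Variables (j1 : {rmorphism A1 -> A12}) (j2 : {rmorphism A2 -> A12}).
Hypotheses (j1_bounded : norm_bounded j1) (j2_bounded : norm_bounded j2).
Hypothesis split12 : bounded_splitting j1 j2.
Hypothesis dense2 : dense_image j2.

(** A transvection is invertible whatever its off-diagonal block, so approximating that block over
    [A2] already gives a unit; the multiplicative error is the error on the block. *)
Lemma utransv_approximable n1 n2 (U : 'M[A12]_(n1, n2)) :
  unit_approximable (map_mx j2 : {rmorphism 'M_(n1 + n2) -> 'M_(n1 + n2)}) (utransv U).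
Proof.
move=> e e0; have [Y UY] := map_mx_dense_image dense2 U e0.
exists (utransv Y), (utransv (- Y)); rewrite !utransvM addNr subrr utransv0; split=> //.
rewrite /= map_utransv utransvM map_mxN utransv_sub1 bnorm_block_mx !bnorm0.
by rewrite !(add0r, addr0) addrC.
Qed.

Lemma ltransv_approximable n1 n2 (U : 'M[A12]_(n2, n1)) :
  unit_approximable (map_mx j2 : {rmorphism 'M_(n1 + n2) -> 'M_(n1 + n2)}) (ltransv U).
Proof.
move=> e e0; have [Y UY] := map_mx_dense_image dense2 U e0.
exists (ltransv Y), (ltransv (- Y)); rewrite !ltransvM addNr subrr ltransv0; split=> //.
rewrite /= map_ltransv ltransvM map_mxN ltransv_sub1 bnorm_block_mx !bnorm0.
by rewrite !(add0r, addr0).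
Qed.

Lemma banach_factors_transvections : factors_transvections j1 j2.
Proof.
move=> n1 n2 U U'; apply: (@unit_approximable_factor R 'M[A1]_(n1 + n2) 'M[A2]_(n1 + n2)
    'M[A12]_(n1 + n2) (map_mx j1) (map_mx j2)).
- exact: map_mx_norm_bounded.
- exact: map_mx_norm_bounded.
- exact: map_mx_bounded_splitting.
- apply: unit_approximableM (utransv_approximable _).
  exact: unit_approximableM (utransv_approximable _) (ltransv_approximable _).
Qed.

End TransvectionFactorization.

(** * Dual bases *)

Section LinearOf.
Variables (A : pzRingType) (M N : lmodType A) (f : M -> N).

(** The alias is indexed by the linearity proof, so that a function defined in the course of a proof
    receives a linear structure. *)
Definition linear_of (f_linear : linear f) := f.

HB.instance Definition _ (f_linear : linear f) :=
  GRing.isLinear.Build A M N *:%R (linear_of f_linear) f_linear.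

Definition to_linear (f_linear : linear f) : {linear M -> N} := linear_of f_linear.

End LinearOf.

Arguments linear_of {A M N f} f_linear /.

Section Combinations.
Variables (A : pzRingType) (M : lmodType A).

(** Families of module elements are treated as columns: [comb] multiplies a column by a row of
    scalars, [mxact] multiplies it by a matrix, and [join] stacks two columns. *)
Definition comb n (c : 'rV[A]_n) (x : 'I_n -> M) : M := \sum_j c 0 j *: x j.

Definition mxact m n (T : 'M[A]_(m, n)) (x : 'I_n -> M) : 'I_m -> M :=
  fun i => comb (row i T) x.

Definition join n1 n2 (x : 'I_n1 -> M) (y : 'I_n2 -> M) (i : 'I_(n1 + n2)) : M :=
  match split i with inl i1 => x i1 | inr i2 => y i2 end.

Lemma eq_comb n (c : 'rV[A]_n) x y : x =1 y -> comb c x = comb c y.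
Proof. by move=> xy; apply: eq_bigr => j _; rewrite xy. Qed.

Lemma comb_mul m n c (T : 'M_(m, n)) x : comb (c *m T) x = comb c (mxact T x).
Proof.
rewrite /comb (eq_bigr (fun k => \sum_j (c 0 j * T j k) *: x k)); last first.
  by move=> k _; rewrite mxE scaler_suml.
rewrite exchange_big; apply: eq_bigr => j _; rewrite scaler_sumr.
by apply: eq_bigr => k _; rewrite mxE scalerA.
Qed.

Lemma mxactM m n p (T : 'M_(m, n)) (T' : 'M_(n, p)) x :
  mxact (T *m T') x =1 mxact T (mxact T' x).
Proof. by move=> i; rewrite /mxact row_mul comb_mul. Qed.

Lemma comb_delta n (x : 'I_n -> M) i : comb (delta_mx 0 i) x = x i.
Proof.
rewrite /comb (bigD1 i) //= mxE !eqxx scale1r big1 ?addr0 // => j /negPf ji.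
by rewrite mxE ji andbF scale0r.
Qed.

Lemma mxact1 n (x : 'I_n -> M) : mxact 1%:M x =1 x.
Proof. by move=> i; rewrite /mxact row1 comb_delta. Qed.

Lemma comb0 n (x : 'I_n -> M) : comb 0 x = 0.
Proof. by apply: big1 => j _; rewrite mxE scale0r. Qed.

Lemma combN n c (x : 'I_n -> M) : comb (- c) x = - comb c x.
Proof. by rewrite -sumrN; apply: eq_bigr => j _; rewrite mxE scaleNr. Qed.

Lemma comb_family0 n (c : 'rV_n) : comb c (fun=> 0 : M) = 0.
Proof. by apply: big1 => j _; rewrite scaler0. Qed.

Lemma joinl n1 n2 (x : 'I_n1 -> M) (y : 'I_n2 -> M) i : join x y (lshift n2 i) = x i.
Proof. by rewrite /join (unsplitK (inl i : 'I_n1 + 'I_n2)). Qed.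

Lemma joinr n1 n2 (x : 'I_n1 -> M) (y : 'I_n2 -> M) i : join x y (rshift n1 i) = y i.
Proof. by rewrite /join (unsplitK (inr i : 'I_n1 + 'I_n2)). Qed.

Lemma comb_join n1 n2 c d (x : 'I_n1 -> M) (y : 'I_n2 -> M) :
  comb (row_mx c d) (join x y) = comb c x + comb d y.
Proof.
rewrite /comb big_split_ord /=; congr (_ + _); apply: eq_bigr => j _.
  by rewrite row_mxEl joinl.
by rewrite row_mxEr joinr.
Qed.

Lemma mxact_block m1 m2 n1 n2 (T1 : 'M_(m1, n1)) (T2 : 'M_(m1, n2))
    (T3 : 'M_(m2, n1)) (T4 : 'M_(m2, n2)) x y :
  mxact (block_mx T1 T2 T3 T4) (join x y) =1
  join (fun i => mxact T1 x i + mxact T2 y i) (fun i => mxact T3 x i + mxact T4 y i).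
Proof.
move=> i; rewrite /mxact /block_mx /join; case: splitP => k ik.
  have -> : i = lshift m2 k by apply: val_inj.
  by rewrite rowKu row_row_mx comb_join.
have -> : i = rshift m1 k by apply: val_inj.
by rewrite rowKd row_row_mx comb_join.
Qed.

End Combinations.

Lemma comb_semilinear (A B : pzRingType) (f : {rmorphism A -> B})
    (M : lmodType A) (N : lmodType B) (psi : {additive M -> N}) n c (x : 'I_n -> M) :
  (forall a m, psi (a *: m) = f a *: psi m) ->
  psi (comb c x) = comb (map_mx f c) (psi \o x).
Proof.
move=> psiZ; rewrite raddf_sum; apply: eq_bigr => j _.
by rewrite psiZ mxE.
Qed.

Lemma mxact_semilinear (A B : pzRingType) (f : {rmorphism A -> B})
    (M : lmodType A) (N : lmodType B) (psi : {additive M -> N}) m n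
    (T : 'M_(m, n)) (x : 'I_n -> M) i :
  (forall a m, psi (a *: m) = f a *: psi m) ->
  psi (mxact T x i) = mxact (map_mx f T) (psi \o x) i.
Proof. by move=> psiZ; rewrite /mxact (comb_semilinear _ _ psiZ) map_row. Qed.

Lemma comb_linear (A : pzRingType) (M N : lmodType A) (f : {linear M -> N}) n c
    (x : 'I_n -> M) :
  f (comb c x) = comb c (f \o x).
Proof. by rewrite linear_sum; apply: eq_bigr => j _; rewrite linearZ. Qed.

Lemma row_comb (A : pzRingType) m n (c : 'rV[A]_m) (T : 'M[A]_(m, n)) :
  comb c (fun i => row i T) = c *m T.
Proof.
rewrite /comb; apply/rowP => j; rewrite summxE mxE.
by apply: eq_bigr => i _; rewrite !mxE.
Qed.

(** A dual basis: the forms are gathered into one map [g] to row vectors, which is taken linear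
    wherever this matters. *)
Definition is_frame (A : pzRingType) (M : lmodType A) n
    (x : 'I_n -> M) (g : M -> 'rV[A]_n) : Prop :=
  forall m, m = comb (g m) x.

Section Frames.
Variables (A : pzRingType) (M : lmodType A).

(** The generators give a surjection from a free module, and projectivity splits it; the coordinates
    of the section are the forms. *)
Lemma finite_projective_frame : finite_projective M ->
  exists n (x : 'I_n -> M) (g : {linear M -> 'rV[A]_n}), is_frame x g.
Proof.
move=> [[n [x x_gen]] Mproj].
have comb_linear_fun : linear (fun c : 'rV[A]_n => comb c x).
  move=> a c d; rewrite /comb scaler_sumr -big_split; apply: eq_bigr => j _ /=.
  by rewrite !mxE scalerDl scalerA.
pose combL : {linear 'rV[A]_n -> M} :=
  to_linear comb_linear_fun.
have [y|g gP] := Mproj _ _ combL idfun.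
  have [c ->] := x_gen y; exists (\row_j c j).
  by apply: eq_bigr => j _; rewrite mxE.
by exists n, x, g => m; rewrite [RHS]gP.
Qed.

(** To lift [h] along [p], lift the finitely many values [h (x j)] and recombine them with the
    coordinates [g]. *)
Lemma frame_finite_projective n (x : 'I_n -> M) (g : {linear M -> 'rV[A]_n}) :
  is_frame x g -> finite_projective M.
Proof.
move=> xg; split; first by exists n, x => m; exists (g m 0); apply: xg.
move=> X Y p h p_surj; have /choice[y yP] j : exists y, p y = h (x j) by apply: p_surj.
have lin : linear (fun m => comb (g m) y).
  move=> a m m'; rewrite linearP /comb scaler_sumr -big_split.
  by apply: eq_bigr => j _ /=; rewrite !mxE scalerDl scalerA.
exists (to_linear lin) => m /=.
rewrite [in RHS](xg m) !comb_linear; exact: eq_comb.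
Qed.

End Frames.

(* The universal property of the base change [M -> B (x)_A M], as a semilinear map. *)
Record is_base_change (A B : pzRingType) (f : {rmorphism A -> B})
    (M : lmodType A) (N : lmodType B) (psi : {additive M -> N}) : Prop := {
  base_changeZ : forall a m, psi (a *: m) = f a *: psi m;
  base_change_ext : forall (X : lmodType B) (F : {additive M -> X}),
    (forall a m, F (a *: m) = f a *: F m) ->
    exists F' : {linear N -> X}, forall m, F' (psi m) = F m;
  base_change_eq : forall (X : lmodType B) (F F' : {linear N -> X}),
    (forall m, F (psi m) = F' (psi m)) -> F =1 F'
}.

(** The forms extend by the universal property. The frame identity over [B] equates two linear
    endomorphisms of [N], hence needs checking only on the image of [psi]. *)
Lemma base_change_frame (A B : pzRingType) (f : {rmorphism A -> B})
    (M : lmodType A) (N : lmodType B) (psi : {additive M -> N})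
    n (x : 'I_n -> M) (g : {linear M -> 'rV[A]_n}) :
  is_base_change f psi -> is_frame x g ->
  exists g' : {linear N -> 'rV[B]_n},
    is_frame (psi \o x) g' /\ forall m, g' (psi m) = map_mx f (g m).
Proof.
move=> [psiZ ext ext_eq] xg.
pose F : {additive M -> 'rV[B]_n} := map_mx f \o g.
have [|g' g'P] := ext _ F.
  by move=> a m; rewrite /F /= linearZ /= map_mxZ.
exists g'; split=> // y.
have lin : linear (fun y => comb (g' y) (psi \o x)).
  move=> a m m'; rewrite linearP /comb scaler_sumr -big_split.
  by apply: eq_bigr => j _ /=; rewrite !mxE scalerDl scalerA.
pose h : {linear N -> N} := to_linear lin.
apply: (ext_eq _ idfun h) => m /=.
by rewrite g'P -(comb_semilinear _ _ psiZ) -xg.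
Qed.

(** * Compatible dual bases, and the dual basis of the kernel *)

Section GlueFrames.
Variables (A1 A2 A12 : pzRingType).
Variables (j1 : {rmorphism A1 -> A12}) (j2 : {rmorphism A2 -> A12}).
Variables (M1 : lmodType A1) (M2 : lmodType A2) (M12 : lmodType A12).
Variables (psi1 : {additive M1 -> M12}) (psi2 : {additive M2 -> M12}).
Hypothesis factor12 : factors_transvections j1 j2.
Hypotheses (psi1_bc : is_base_change j1 psi1) (psi2_bc : is_base_change j2 psi2).
Hypotheses (M1_fp : finite_projective M1) (M2_fp : finite_projective M2).

Lemma compatible_frames : exists n
    (x1 : 'I_n -> M1) (g1 : {linear M1 -> 'rV[A1]_n})
    (x2 : 'I_n -> M2) (g2 : {linear M2 -> 'rV[A2]_n}),
  [/\ is_frame x1 g1, is_frame x2 g2,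
      forall j, psi1 (x1 j) = psi2 (x2 j) &
      forall m1 m2, psi1 m1 = psi2 m2 -> map_mx j1 (g1 m1) = map_mx j2 (g2 m2)].
Proof.
have [n1 [v [f1 vf]]] := finite_projective_frame M1_fp.
have [n2 [w [f2 wf]]] := finite_projective_frame M2_fp.
have [F1 [VF F1E]] := base_change_frame psi1_bc vf.
have [F2 [WF F2E]] := base_change_frame psi2_bc wf.
set V := psi1 \o v in VF; set W := psi2 \o w in WF.
pose U : 'M[A12]_(n1, n2) := \matrix_i F2 (V i).
pose U' : 'M[A12]_(n2, n1) := \matrix_i F1 (W i).
have F1U m : F1 m *m U = F2 m.
  rewrite [in RHS](VF m) comb_linear -row_comb; apply: eq_comb => i.
  by rewrite rowK.
have F2U m : F2 m *m U' = F1 m.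
  rewrite [in RHS](WF m) comb_linear -row_comb; apply: eq_comb => i.
  by rewrite rowK.
have UW : mxact U W =1 V by move=> i; rewrite /mxact rowK -WF.
have U'V : mxact U' V =1 W by move=> i; rewrite /mxact rowK -VF.
have [T1 [T2 [[T1' [T11 T1'1]] [T2' [T22 T2'2]] TE]]] := factor12 U U'.
(* Through the three transvections the row [(F1, 0)] becomes [(F1, F2)], then [(0, F2)], which the
   last one fixes. *)
have gW m : row_mx (F1 m) 0 *m map_mx j1 T1 *m map_mx j2 T2 = row_mx 0 (F2 m).
  rewrite -mulmxA mulmxE -TE -mulmxE !mulmxA /utransv /ltransv.
  rewrite !mul_row_block !mulmx1 !mulmx0 !addr0 F1U mulmxN F2U.
  by rewrite subrr mul0mx !add0r.
(* On columns the rightmost transvection acts first: [(0; W)] becomes [(V; W)], then [(V; 0)], which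
   the last one fixes. *)
have xW : mxact (map_mx j1 T1) (mxact (map_mx j2 T2) (join (fun=> 0) W))
    =1 join V (fun=> 0).
  move=> i; rewrite -mxactM mulmxE -TE -mulmxE !mxactM.
  have -> : mxact (utransv U) (join (fun=> 0) W) = join V W.
    apply: funext => k; rewrite mxact_block /join; case: split => k'.
      by rewrite mxact1 add0r UW.
    by rewrite mxact1 [mxact _ _ _]comb_family0 add0r.
  have -> : mxact (ltransv (- U')) (join V W) = join V (fun=> 0).
    apply: funext => k; rewrite mxact_block /join; case: split => k'.
      by rewrite mxact1 /mxact row0 comb0 addr0.
    by rewrite mxact1 {1}/mxact linearN combN -/(mxact U' V k') U'V addNr.
  rewrite mxact_block /join; case: split => k'.
    by rewrite mxact1 [mxact _ _ _]comb_family0 addr0.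
  by rewrite [mxact 1%:M _ _]comb_family0 addr0 /mxact row0 comb0.
(* The forms change inversely to the elements: [(f1, 0)] is multiplied by [T1] and [(0, f2)] by the
   inverse [T2'] of [T2]. *)
have lin1 : linear (fun m => row_mx (f1 m) (0 : 'rV_n2) *m T1).
  move=> a m m'; rewrite scalemxAl -mulmxDl linearP scale_row_mx add_row_mx.
  by rewrite scaler0 addr0.
have lin2 : linear (fun m => row_mx (0 : 'rV_n1) (f2 m) *m T2').
  move=> a m m'; rewrite scalemxAl -mulmxDl linearP scale_row_mx add_row_mx.
  by rewrite scaler0 addr0.
pose g1 : {linear M1 -> 'rV[A1]_(n1 + n2)} :=
  to_linear lin1.
pose g2 : {linear M2 -> 'rV[A2]_(n1 + n2)} :=
  to_linear lin2.
exists (n1 + n2)%N, (mxact T1' (join v (fun=> 0))), g1, (mxact T2 (join (fun=> 0) w)), g2.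
split.
- move=> m; rewrite /= -comb_mul -mulmxA [T1 *m _]T11 mulmx1 comb_join.
  by rewrite -vf comb0 addr0.
- move=> m; rewrite /= -comb_mul -mulmxA [T2' *m _]T2'2 mulmx1 comb_join.
  by rewrite -wf comb0 add0r.
- move=> i; rewrite (mxact_semilinear _ _ _ (base_changeZ psi1_bc)).
  rewrite (mxact_semilinear _ _ _ (base_changeZ psi2_bc)).
  have -> : psi1 \o join v (fun=> 0) = join V (fun=> 0) :> ('I_(n1 + n2) -> M12).
    by apply: funext => k; rewrite /= /join; case: split => k' //; apply: raddf0.
  have -> : psi2 \o join (fun=> 0) w = join (fun=> 0) W :> ('I_(n1 + n2) -> M12).
    by apply: funext => k; rewrite /= /join; case: split => k' //; apply: raddf0.
  by rewrite -(funext xW) -mxactM -map_mxM [T1' *m _]T1'1 map_mx1 mxact1.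
- move=> m1 m2 m12 /=; rewrite !map_mxM !map_row_mx !map_mx0 -F1E -F2E -m12 -gW.
  by rewrite -!mulmxA -map_mxM [T2 *m _]T22 map_mx1 mulmx1.
Qed.

End GlueFrames.

Section KernelFrame.
Variables (A A1 A2 A12 : pzRingType).
Variables (i1 : {rmorphism A -> A1}) (i2 : {rmorphism A -> A2}).
Variables (j1 : {rmorphism A1 -> A12}) (j2 : {rmorphism A2 -> A12}).
Hypothesis i12_inj : injective (fun a => (i1 a, i2 a)).
Hypothesis i12_ker : forall a1 a2, j1 a1 = j2 a2 -> exists a, i1 a = a1 /\ i2 a = a2.
Variables (M : lmodType A) (M1 : lmodType A1) (M2 : lmodType A2) (M12 : lmodType A12).
Variables (p1 : {additive M -> M1}) (p2 : {additive M -> M2}).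
Variables (psi1 : {additive M1 -> M12}) (psi2 : {additive M2 -> M12}).
Hypothesis p1Z : forall a m, p1 (a *: m) = i1 a *: p1 m.
Hypothesis p2Z : forall a m, p2 (a *: m) = i2 a *: p2 m.
Hypothesis p12_comm : forall m, psi1 (p1 m) = psi2 (p2 m).
Hypothesis p12_inj : injective (fun m => (p1 m, p2 m)).
Hypothesis p12_ker : forall m1 m2, psi1 m1 = psi2 m2 -> exists m, p1 m = m1 /\ p2 m = m2.
Hypothesis factor12 : factors_transvections j1 j2.
Hypotheses (psi1_bc : is_base_change j1 psi1) (psi2_bc : is_base_change j2 psi2).
Hypotheses (M1_fp : finite_projective M1) (M2_fp : finite_projective M2).

(** The hypotheses make [A] and [M] fibre products, so compatible elements and coordinates come from
    [M] and [A]. The frames of [M1] and [M2] are returned as well, because inverting the base change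
    maps requires them. *)
Lemma kernel_frame : exists n (x : 'I_n -> M) (g : {linear M -> 'rV[A]_n})
    (g1 : {linear M1 -> 'rV[A1]_n}) (g2 : {linear M2 -> 'rV[A2]_n}),
  [/\ is_frame x g, is_frame (p1 \o x) g1, is_frame (p2 \o x) g2,
      forall m, g1 (p1 m) = map_mx i1 (g m) & forall m, g2 (p2 m) = map_mx i2 (g m)].
Proof.
have [n [x1 [g1 [x2 [g2 [xg1 xg2 x12 g12]]]]]] :=
  compatible_frames factor12 psi1_bc psi2_bc M1_fp M2_fp.
have /choice[x xP] j : exists m, p1 m = x1 j /\ p2 m = x2 j by apply: p12_ker.
have ex_coord (mj : M * 'I_n) : exists a, i1 a = g1 (p1 mj.1) 0 mj.2
    /\ i2 a = g2 (p2 mj.1) 0 mj.2.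
  apply: i12_ker; have /rowP/(_ mj.2) := g12 _ _ (p12_comm mj.1).
  by rewrite !mxE.
have [c cP] := choice ex_coord.
(* The coordinates were chosen arbitrarily, but injectivity of [A] into [A1 * A2] determines them,
   and linearity is checked there. *)
have lin : linear (fun m => \row_j c (m, j)).
  move=> a m m'; apply/rowP => j; rewrite !mxE; apply: i12_inj.
  have [c1 c2] := cP (a *: m + m', j); have [d1 d2] := cP (m, j).
  have [e1 e2] := cP (m', j).
  rewrite c1 c2 !rmorphD !rmorphM d1 d2 e1 e2 !raddfD /= p1Z p2Z.
  by rewrite !linearZ /= !mxE.
pose g : {linear M -> 'rV[A]_n} :=
  to_linear lin.
have g1E m : g1 (p1 m) = map_mx i1 (g m).
  by apply/rowP => j; rewrite !mxE; case: (cP (m, j)).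
have g2E m : g2 (p2 m) = map_mx i2 (g m).
  by apply/rowP => j; rewrite !mxE; case: (cP (m, j)).
have x1E : p1 \o x = x1 by apply: funext => j; case: (xP j).
have x2E : p2 \o x = x2 by apply: funext => j; case: (xP j).
exists n, x, g, g1, g2; split=> //; rewrite ?x1E ?x2E //.
move=> m; apply: p12_inj.
rewrite (comb_semilinear _ _ p1Z) (comb_semilinear _ _ p2Z) x1E x2E -g1E -g2E.
by rewrite -xg1 -xg2.
Qed.

End KernelFrame.

(** * Base change maps *)

Section Converse.
Variables (A B : pzRingType) (f : {rmorphism A -> B}).

Definition converse_fun : A^c -> B^c := f.

Fact converse_fun_zmod_morphism : zmod_morphism converse_fun.
Proof. exact: (raddfB f). Qed.
HB.instance Definition _ :=
  GRing.isZmodMorphism.Build A^c B^c converse_fun converse_fun_zmod_morphism.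

Fact converse_fun_monoid_morphism : monoid_morphism converse_fun.
Proof. by split=> [|x y]; [apply: (rmorph1 f) | apply: (rmorphM f)]. Qed.
HB.instance Definition _ :=
  GRing.isMonoidMorphism.Build A^c B^c converse_fun converse_fun_monoid_morphism.

Definition converse_morph : {rmorphism A^c -> B^c} := converse_fun.

End Converse.

Section ConverseBanach.
Variables (R : realType) (A : banachRingType R).

HB.instance Definition _ := isNormedGroup.Build R A^c
  (@bnorm_eq0 R A) (@bnormN R A) (@bnormD R A).

(** Reversing the product is harmless because the norms, being real numbers, commute. *)
Fact converse_bnormM (x y : A^c) : bnorm (x * y) <= bnorm x * bnorm y.
Proof. by rewrite mulrC; apply: (@bnormM R A). Qed.

HB.instance Definition _ := NormedGroup_isBanachRing.Build R A^c
  converse_bnormM (@bnorm_complete R A).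

End ConverseBanach.

Section BaseChangeMaps.
Variables (A B : pzRingType) (f : {rmorphism A -> B}).
Variables (M : bimodType A) (N : bimodType B) (phi : bimodHom f M N).

Lemma lbc_map_tens (b : B) (m : M) : lbc_map phi (tens (b : rrestr f) m) = b *: phi m.
Proof. exact: lbc_map_defE. Qed.

Lemma rbc_map_tens (m : M) (b : B) :
  rbc_map phi (tens (m : rmod M) (b : lrestr f)) = (b : B^c) *: (phi m : rmod N).
Proof. exact: rbc_map_defE. Qed.

(** A semilinear [F] extends to the tensor product by [b (x) m |-> b F(m)], and the inverse of
    [lbc_map phi] carries this over to [N]. Uniqueness holds because the elements [b phi(m)] span
    [N] additively. *)
Lemma lbc_is_base_change : bijective (lbc_map phi) -> is_base_change f phi.
Proof.
move=> [h hK Kh]; have h_lin : linear h.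
  by move=> b y z; apply: (can_inj hK); rewrite Kh linearP !Kh.
split=> [a m|X F FZ|X F F' FF'].
- exact: bimod_funZl.
- pose gl (b : rrestr f) (m : M) : X := (b : B) *: F m.
  have glDl b b' m : gl (b + b') m = gl b m + gl b' m by apply: scalerDl.
  have glDr b m m' : gl b (m + m') = gl b m + gl b m' by rewrite /gl raddfD scalerDr.
  have glA b (a : A) m : gl ((a : A^c) *: b) m = gl b (a *: m).
    by rewrite /gl FZ scalerA.
  pose L : {additive lbase_change f M -> X} := tensor_lift (Balanced glDl glDr glA).
  have LE b m : L (tens b m) = b *: F m by apply: tensor_liftE.
  have LZ (b : B) t : L (b *: t) = b *: L t.
    elim/lbc_ind: t => [|x y hx hy|c m]; first by rewrite scaler0 !raddf0.
      by rewrite scalerBr !raddfB /= hx hy.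
    by rewrite [b *: _]lbc_scaleE !LE scalerA.
  have lin : linear (L \o h).
    by move=> b y z; rewrite /= h_lin raddfD /= LZ.
  exists (to_linear lin) => m /=.
  have -> : phi m = lbc_map phi (tens (1 : rrestr f) m) by rewrite lbc_map_tens scale1r.
  by rewrite hK LE scale1r.
- move=> y; rewrite -[y]Kh; move: (h y) => t.
  elim/lbc_ind: t => [|s t hs ht|b m]; first by rewrite !raddf0.
    by rewrite (linearB (lbc_map phi)) (linearB F) (linearB F') hs ht.
  by rewrite lbc_map_tens !linearZ /= FF'.
Qed.

Lemma rbc_is_base_change : bijective (rbc_map phi) ->
  is_base_change (converse_morph f) (bimod_fun phi : {additive rmod M -> rmod N}).
Proof.
move=> [h hK Kh]; have h_lin : linear h.
  by move=> b y z; apply: (can_inj hK); rewrite Kh linearP !Kh.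
split=> [a m|X F FZ|X F F' FF'].
- exact: bimod_funZr.
- pose gl (m : rmod M) (b : lrestr f) : X := (b : B^c) *: F m.
  have glDl m m' b : gl (m + m') b = gl m b + gl m' b by rewrite /gl raddfD scalerDr.
  have glDr m b b' : gl m (b + b') = gl m b + gl m b' by apply: scalerDl.
  have glA m (a : A) b : gl ((a : A^c) *: m) b = gl m (a *: b).
    by rewrite /gl FZ scalerA.
  pose L : {additive rbase_change f M -> X} := tensor_lift (Balanced glDl glDr glA).
  have LE m b : L (tens m b) = (b : B^c) *: F m by apply: tensor_liftE.
  have LZ (b : B^c) t : L (b *: t) = b *: L t.
    elim/rbc_ind: t => [|x y hx hy|m c]; first by rewrite scaler0 !raddf0.
      by rewrite scalerBr !raddfB /= hx hy.
    by rewrite [b *: _]rbc_scaleE !LE scalerA.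
  have lin : linear (L \o h).
    by move=> b y z; rewrite /= h_lin raddfD /= LZ.
  exists (to_linear lin) => m /=.
  have -> : phi m = rbc_map phi (tens m (1 : lrestr f)) by rewrite rbc_map_tens scale1r.
  by rewrite hK LE scale1r.
- move=> y; rewrite -[y]Kh; move: (h y) => t.
  elim/rbc_ind: t => [|s t hs ht|m b]; first by rewrite !raddf0.
    by rewrite (linearB (rbc_map phi)) (linearB F) (linearB F') hs ht.
  by rewrite rbc_map_tens !linearZ /= FF'.
Qed.

(** The inverse sends [y] to the sum of the [g'_j(y) (x) x_j]. On the image of [M] the coordinates
    come from [A], so they move across the tensor sign and reassemble [m]. *)
Lemma lbc_map_bijective n (x : 'I_n -> M) (g : {linear M -> 'rV[A]_n})
    (g' : {linear N -> 'rV[B]_n}) :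
  is_frame x g -> is_frame (phi \o x) g' ->
  (forall m, g' (phi m) = map_mx f (g m)) -> bijective (lbc_map phi).
Proof.
move=> xg xg' g'E.
pose h y : lbase_change f M := \sum_j tens (g' y 0 j : rrestr f) (x j).
have hB : zmod_morphism h.
  move=> y z; rewrite -sumrB; apply: eq_bigr => j _; rewrite raddfB !mxE.
  by apply/(canRL (addrK _)); rewrite -tensDl subrK.
have hZ (b : B) y : h (b *: y) = b *: h y.
  rewrite scaler_sumr; apply: eq_bigr => j _.
  by rewrite [RHS]lbc_scaleE linearZ mxE.
exists h => [t|y]; last first.
  rewrite [RHS]xg' linear_sum; apply: eq_bigr => j _; exact: lbc_map_tens.
elim/lbc_ind: t => [|s t hs ht|b m].
- by rewrite raddf0 -(subrr 0) hB subrr.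
- by rewrite raddfB hB hs ht.
rewrite lbc_map_tens hZ.
(* By linearity over [B] only the tensors [1 (x) m] remain. *)
have -> : tens b m = b *: (tens (1 : rrestr f) m : lbase_change f M).
  by rewrite [RHS]lbc_scaleE mulr1.
congr (_ *: _); rewrite [in RHS](xg m) /h /comb.
have tens_sum (F : 'I_n -> M) :
    tens (1 : rrestr f) (\sum_j F j) = \sum_j tens (1 : rrestr f) (F j).
  apply: (big_morph (fun m : M => tens (1 : rrestr f) m)) => [u v|]; first exact: tensDr.
  by apply: (addIr (tens (1 : rrestr f) (0 : M))); rewrite -tensDr addr0 add0r.
rewrite tens_sum; apply: eq_bigr => j _; rewrite -tensA g'E mxE; congr tens.
by rewrite /GRing.scale /= /rrestr_scale mul1r.
Qed.

Lemma rbc_map_bijective n (x : 'I_n -> rmod M) (g : {linear rmod M -> 'rV[A^c]_n})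
    (g' : {linear rmod N -> 'rV[B^c]_n}) :
  is_frame x g -> is_frame ((bimod_fun phi : {additive rmod M -> rmod N}) \o x) g' ->
  (forall m, g' (phi m) = map_mx (converse_morph f) (g m)) -> bijective (rbc_map phi).
Proof.
move=> xg xg' g'E.
pose h y : rbase_change f M := \sum_j tens (x j) (g' y 0 j : lrestr f).
have hB : zmod_morphism h.
  move=> y z; rewrite -sumrB; apply: eq_bigr => j _; rewrite raddfB !mxE.
  by apply/(canRL (addrK _)); rewrite -tensDr subrK.
have hZ (b : B^c) y : h (b *: y) = b *: h y.
  rewrite scaler_sumr; apply: eq_bigr => j _.
  by rewrite [RHS]rbc_scaleE linearZ mxE.
exists h => [t|y]; last first.
  rewrite [RHS]xg' linear_sum; apply: eq_bigr => j _; exact: rbc_map_tens.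
elim/rbc_ind: t => [|s t hs ht|m b].
- by rewrite raddf0 -(subrr 0) hB subrr.
- by rewrite raddfB hB hs ht.
rewrite rbc_map_tens hZ.
have -> : tens m b = (b : B^c) *: (tens m (1 : lrestr f) : rbase_change f M).
  by rewrite [RHS]rbc_scaleE mul1r.
congr (_ *: _); rewrite [in RHS](xg m) /h /comb.
have tens_sum (F : 'I_n -> rmod M) :
    tens (\sum_j F j) (1 : lrestr f) = \sum_j tens (F j) (1 : lrestr f).
  apply: (big_morph (fun m : rmod M => tens m (1 : lrestr f))) => [u v|]; first exact: tensDl.
  by apply: (addIr (tens (0 : rmod M) (1 : lrestr f))); rewrite -tensDl addr0 add0r.
rewrite tens_sum; apply: eq_bigr => j _; rewrite tensA g'E mxE; congr tens.
by rewrite /GRing.scale /= /lrestr_scale mulr1.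
Qed.

End BaseChangeMaps.

(** * Glueing *)

(** Strictness bounds the quotient norm, an infimum that need not be attained. Passing from [C] to
    [C + 1] leaves room for an actual lift when [w] is nonzero; 0 is lifted by 0. *)
Lemma strict_lift (R : realType) (V W : normedGroupType R) (g : V -> W) :
  g 0 = 0 -> strict g -> (forall w, exists v, g v = w) ->
  exists C : R, forall w, exists2 v, g v = w & bnorm v <= C * bnorm w.
Proof.
move=> g0 [_ [c [C [_ _ gC]]]] g_surj; exists (C + 1) => w.
have [->|w0] := EM (w = 0); first by exists 0; rewrite ?bnorm0 ?mulr0.
have w_gt0 : 0 < bnorm w.
  by rewrite lt_neqAle bnorm_ge0 andbT eq_sym; apply/eqP => /bnorm_eq0.
have [|_ qC] := andP (gC w _); first exact: g_surj.
have [v0 v0w] := g_surj w.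
have q_lt : quotient_norm g w < (C + 1) * bnorm w.
  by apply: le_lt_trans qC _; rewrite mulrDl mul1r ltrDl.
have [|_ [v vw <-] vlt] := inf_lt _ q_lt; first by exists (bnorm v0), v0.
by exists v => //; apply: ltW.
Qed.

Lemma strict_bounded_splitting (R : realType) (V1 V2 W : normedGroupType R)
    (f1 : {additive V1 -> W}) (f2 : {additive V2 -> W}) :
  strict (fun p : V1 * V2 => f1 p.1 - f2 p.2) ->
  (forall w, exists p : V1 * V2, f1 p.1 - f2 p.2 = w) -> bounded_splitting f1 f2.
Proof.
move=> st surj; have [|C lift] := strict_lift _ st surj.
  by rewrite /= (raddf0 f1) (raddf0 f2) subrr.
exists C => w; have [[a b] <- le_ab] := lift w; exists (a, - b); split=> /=.
- by rewrite raddfN.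
- by apply: le_trans le_ab; rewrite le_max lexx.
- by apply: le_trans le_ab; rewrite bnormN le_max lexx orbT.
Qed.

Theorem proposition1p5 (R : realType) (k : comBanachRingType R)
    (P P1 P2 P12 : banachAlgType k)
    (i1 : boundedHom P P1) (i2 : boundedHom P P2)
    (j1 : boundedHom P1 P12) (j2 : boundedHom P2 P12)
    (comm : forall a : P, j1 (i1 a) = j2 (i2 a))
    (exact : short_strict_exact (fun a : P => (i1 a, i2 a))
       (fun b : P1 * P2 => j1 b.1 - j2 b.2))
    (dense : dense_image j2)
    (M1 : bimodType P1) (M2 : bimodType P2) (M12 : bimodType P12)
    (phi1 : bimodHom j1 M1 M12) (phi2 : bimodHom j2 M2 M12)
    (glue : fp_glueing_datum phi1 phi2) :
  let M : bimodType P := glue_ker phi1 phi2 comm in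
  let pr1 : bimodHom i1 M M1 := glue_pr1 comm phi1 phi2 in
  let pr2 : bimodHom i2 M M2 := glue_pr2 comm phi1 phi2 in
  finite_projective_bimod M /\
  [/\ bijective (rbc_map pr1), bijective (rbc_map pr2),
      bijective (lbc_map pr1) & bijective (lbc_map pr2)].
Proof.
move=> M pr1 pr2; case: exact => _ strict12 i12_inj ker12 surj12.
(* Exactness in the middle presents [P] as the fibre product of [P1] and [P2] over [P12]. *)
have i12_ker a1 a2 : j1 a1 = j2 a2 -> exists a, i1 a = a1 /\ i2 a = a2.
  move=> a12; have /(ker12 (a1, a2))[a [<- <-]] : j1 a1 - j2 a2 = 0 by rewrite a12 subrr.
  by exists a.
have split12 := strict_bounded_splitting strict12 surj12.
have [bounded1 bounded2] := (bhom_bounded j1, bhom_bounded j2).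
have pr_comm m : phi1 (pr1 m) = phi2 (pr2 m).
  by apply/eqP; rewrite -subr_eq0; apply: (glue_valP m).
have pr_inj : injective (fun m => (pr1 m, pr2 m)).
  by move=> [[a b] ab] [[c d] cd] [ac bd]; apply: val_inj; congr (_, _).
have pr_ker m1 m2 : phi1 m1 = phi2 m2 -> exists m, pr1 m = m1 /\ pr2 m = m2.
  move=> m12; have h : in_glue_ker phi1 phi2 (m1, m2).
    by rewrite /in_glue_ker /glue_diff /= m12 subrr.
  by exists (GlueKer comm h).
case: glue => -[fp1l fp1r] [fp2l fp2r] _ r1 r2 l1 l2.
have factl := banach_factors_transvections bounded1 bounded2 split12 dense.
(* The converse rings have the same underlying normed groups and maps, so boundedness, splitting and
   density carry over verbatim. *)
have factr : factors_transvections (converse_morph j1) (converse_morph j2).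
  exact: (@banach_factors_transvections R P1^c P2^c P12^c).
have [nl [xl [gl [gl1 [gl2 [xgl xgl1 xgl2 gl1E gl2E]]]]]] :=
  kernel_frame i12_inj i12_ker (bimod_funZl pr1) (bimod_funZl pr2) pr_comm pr_inj
    pr_ker factl (lbc_is_base_change l1) (lbc_is_base_change l2) fp1l fp2l.
(* The right structures get a dual basis of their own, obtained from the same argument over the
   converse rings. *)
have [nr [xr [gr [gr1 [gr2 [xgr xgr1 xgr2 gr1E gr2E]]]]]] :=
  @kernel_frame P^c P1^c P2^c P12^c (converse_morph i1) (converse_morph i2)
    (converse_morph j1) (converse_morph j2) i12_inj i12_ker
    (rmod M) (rmod M1) (rmod M2) (rmod M12)
    (bimod_fun pr1) (bimod_fun pr2) (bimod_fun phi1) (bimod_fun phi2)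
    (fun a m => bimod_funZr pr1 m a) (fun a m => bimod_funZr pr2 m a) pr_comm pr_inj
    pr_ker factr (rbc_is_base_change r1) (rbc_is_base_change r2) fp1r fp2r.
split.
  split; first exact: frame_finite_projective xgl.
  exact: frame_finite_projective xgr.
split.
- exact: rbc_map_bijective xgr xgr1 gr1E.
- exact: rbc_map_bijective xgr xgr2 gr2E.
- exact: lbc_map_bijective xgl xgl1 gl1E.
- exact: lbc_map_bijective xgl xgl2 gl2E.
Qed.
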